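(* Let $\alpha\in(0,1)$ be an irrational number which is not of bounded type. Then there is $\beta\in H_1(\alpha)$ such that for Lebesgue-a.e. $\gamma$ the following two properties hold: a) the cocycle $\varphi_{\beta,\gamma}$ (viewed as a $\mathbb{Z}$-valued cocycle over the rotation $T_\alpha$) is non-regular; b) for every non-zero integer $a$, the compact quotient $$(x,\ y \bmod a)\mapsto (x+\alpha \bmod 1,\ y+\varphi_{\beta,\gamma}(x) \bmod a)$$ acting on $\mathbb{T}^1\times \mathbb{Z}/a\mathbb{Z}$ (with the product of Lebesgue measure and the uniform measure) is ergodic.
   Context: $X=\mathbb{T}^1=\mathbb{R}/\mathbb{Z}$ with Lebesgue measure $\mu$, $T_\alpha:x\mapsto x+\alpha \bmod 1$. For $\beta\in\mathbb{T}^1$ (identified with its representative in $[0,1)$) and $\gamma\in\mathbb{R}$, $\varphi_{\beta,\gamma}(x):=1_{[0,\beta]}(x)-1_{[0,\beta]}(x+\gamma)$, arguments being taken modulo 1. Continued fractions: $\alpha=[0;a_1,a_2,\dots]$ with convergents $p_n/q_n$ ($q_{-1}=0$, $q_0=1$, $q_n=a_nq_{n-1}+q_{n-2}$). $\alpha$ is of bounded type if the sequence $(a_n)$ is bounded. For $r\ge 1$, $H_r(\alpha)$ is the set of $\beta\in\mathbb{T}^1$ which can be written $\beta=\sum_{j\ge1} b_j q_j\alpha \bmod 1$ with integers $b_j\in\mathbb{Z}$ such that $\sum_{j\ge1}|b_j|^r/a_{j+1}<\infty$. Cocycles: let $T$ be an ergodic measure-preserving invertible transformation of a probability space $(X,\mu)$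 and $G$ an abelian locally compact second countable group with Haar measure $m_G$. A measurable $\varphi:X\to G$ is called a cocycle; it generates $\varphi_n(x)=\sum_{j=0}^{n-1}\varphi(T^jx)$ for $n\ge1$ (extended to $n\in\mathbb{Z}$ by the relation $T_\varphi^n(x,g)=(T^nx,g+\varphi_n(x))$, where $T_\varphi(x,g)=(Tx,g+\varphi(x))$). $\varphi$ is ergodic if $T_\varphi$ is ergodic for $\mu\times m_G$. An element $a\in G$ is a (finite) essential value of $\varphi$ if for every neighborhood $V(a)$ of $a$ and every measurable $B$ with $\mu(B)>0$ there is $n\in\mathbb{Z}$ with $\mu(B\cap T^{-n}B\cap\{x:\varphi_n(x)\in V(a)\})>0$. The set $\mathcal{E}(\varphi)$ of finite essential values is a closed subgroup of $G$. The cocycle $\varphi$ is regular if there are a measurable $\eta:X\to G$ and a cocycle $\psi=\varphi+\eta-\eta\circ T$ with values in $\mathcal{E}(\varphi)$ such that $\psi$ is ergodic as an $\mathcal{E}(\varphi)$-valued cocycle; otherwise it is non-regular. *)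

(* Defs.v *)
From HB Require Import structures.
From mathcomp Require Import all_boot all_order all_algebra.
From mathcomp Require Import all_classical all_reals all_analysis.
From mathcomp Require Import measurable_realfun.

Set Implicit Arguments.
Unset Strict Implicit.
Unset Printing Implicit Defensive.

Import Order.TTheory GRing.Theory Num.Theory.
Import numFieldNormedType.Exports.

Local Open Scope classical_set_scope.
Local Open Scope ring_scope.

HB.instance Definition _ := isPointed.Build int 0.
HB.instance Definition _ := hasNbhs.Build int principal_filter.
HB.instance Definition _ := Discrete_ofNbhs.Build int erefl.
HB.instance Definition _ := @isMeasurable.Build default_measure_display
  int discrete_measurable discrete_measurable0
  discrete_measurableC discrete_measurableU.

Lemma measurable_int (A : set int) : measurable A.
Proof. by []. Qed.

HB.instance Definition _ n := isPointed.Build 'I_n.+1 ord0.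
HB.instance Definition _ n := @isMeasurable.Build default_measure_display
  'I_n.+1 discrete_measurable discrete_measurable0
  discrete_measurableC discrete_measurableU.

(* For a <> 0 this is Z/aZ, addition in ['I_n.+1] being modulo n.+1.
   (['Z_n] would be wrong for n = 1.) *)
Notation Zmod a := 'I_(`|a|%N.-1.+1).

Definition residue (a m : int) : Zmod a := inZp `|(m %% a)%Z|%N.

Definition uniform_Zmod (R : realType) (a : int) : set (Zmod a) -> \bar R :=
  mscale (`|a|%N%:R^-1)%:nng (@counting (Zmod a) R).
Arguments uniform_Zmod : clear implicits.

(* R/Z, carried by the representatives in [0, 1) *)
Definition circle (R : realType) : Type := {x : R | (0 <= x) && (x < 1)}.

Section circle.
Variable R : realType.

HB.instance Definition _ :=
  SubChoice.copy (circle R) {x : R | (0 <= x) && (x < 1)}.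

Let frac_subproof (x : R) :
  (0 <= x - (Num.floor x)%:~R) && (x - (Num.floor x)%:~R < 1).
Proof.
rewrite subr_ge0 ge_floor/= ltrBlDl.
by have := floorD1_gt x; rewrite intrD.
Qed.

Definition to_circle (x : R) : circle R :=
  exist _ (x - (Num.floor x)%:~R) (frac_subproof x).

Lemma to_circleDz (x : R) (n : int) : to_circle (x + n%:~R) = to_circle x.
Proof.
apply: val_inj => /=; rewrite floorDrz ?intr_int// intrKfloor intrD.
by rewrite opprD addrACA subrr addr0.
Qed.

Lemma to_circleK (x : circle R) : to_circle (val x) = x.
Proof.
apply: val_inj => /=; have /andP[x0 x1] := valP x.
by rewrite (@floor_def _ _ 0) ?subr0// x0 add0r.
Qed.

Let addc (x y : circle R) := to_circle (val x + val y).
Let oppc (x : circle R) := to_circle (- val x).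

Let to_circleDl (x y : R) :
  to_circle (val (to_circle x) + y) = to_circle (x + y).
Proof. by rewrite /= -addrA (addrC (- _)) addrA -mulrNz to_circleDz. Qed.

Let addcC : commutative addc.
Proof. by move=> x y; rewrite /addc addrC. Qed.

Let addcA : associative addc.
Proof.
move=> x y z; rewrite /addc to_circleDl [X in to_circle X]addrC.
by rewrite to_circleDl addrC addrA.
Qed.

Let add0c : left_id (to_circle 0) addc.
Proof. by move=> x; rewrite /addc to_circleDl add0r to_circleK. Qed.

Let addNc : left_inverse (to_circle 0) oppc addc.
Proof. by move=> x; rewrite /addc to_circleDl addNr. Qed.

HB.instance Definition _ :=
  GRing.isZmodule.Build (circle R) addcA addcC add0c addNc.

Lemma to_circleD (x y : R) : to_circle (x + y) = to_circle x + to_circle y.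
Proof.
rewrite -[RHS]/(addc (to_circle x) (to_circle y)) /addc to_circleDl.
by rewrite [in RHS]addrC to_circleDl addrC.
Qed.

HB.instance Definition _ := isPointed.Build (circle R) 0.

Definition circle_val (x : circle R) : measurableTypeR R := val x.

HB.instance Definition _ :=
  Measurable.copy (circle R) (g_sigma_algebra_preimageType circle_val).

Lemma measurable_to_circle :
  measurable_fun [set: measurableTypeR R] (to_circle : measurableTypeR R -> _).
Proof.
move=> _ _ [B mB <-]; rewrite !setTI.
have -> : to_circle @^-1` (circle_val @^-1` B) =
    \bigcup_(k : int) ([set` `[k%:~R, (k + 1)%:~R[%R] `&`
      ((fun x : measurableTypeR R => x - k%:~R : measurableTypeR R) @^-1` B)).
  apply/seteqP; split => [x Bx|x [k _ [/= + Bx]]].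
    exists (Num.floor x) => //; split => //=.
    by rewrite in_itv/= floor_itv.
  by rewrite in_itv/= => /floor_def kx; rewrite /circle_val /= kx.
apply: countable_bigcupT_measurable; first exact: countableP.
move=> k; apply: measurableI => //.
rewrite -[X in measurable X]setTI.
by apply: measurable_funB => //; exact: measurable_cst.
Qed.

Let lebesgue01 : {measure set (measurableTypeR R) -> \bar R} :=
  mrestr lebesgue_measure (measurable_itv `[0%R, 1%R[).

Definition circle_measure : set (circle R) -> \bar R :=
  pushforward (mrestr lebesgue_measure (measurable_itv `[0%R, 1%R[))
    (to_circle : measurableTypeR R -> circle R).

Let mf := measurable_to_circle.

Let circle_measure0 : circle_measure set0 = 0%E.
Proof. exact: (measure0 (pushforward lebesgue01 to_circle)). Qed.

Let circle_measure_ge0 A : (0 <= circle_measure A)%E.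
Proof. exact: (measure_ge0 (pushforward lebesgue01 to_circle)). Qed.

Let circle_measure_sigma_additive : semi_sigma_additive circle_measure.
Proof.
exact: (@measure_semi_sigma_additive _ _ _ (pushforward lebesgue01 to_circle)).
Qed.

HB.instance Definition _ := isMeasure.Build _ _ _ circle_measure
  circle_measure0 circle_measure_ge0 circle_measure_sigma_additive.

Let circle_measureT : circle_measure [set: circle R] = 1%E.
Proof.
rewrite /circle_measure /pushforward preimage_setT /mrestr setTI.
by rewrite lebesgue_measure_itv/= lte_fin ltr01 sube0.
Qed.

HB.instance Definition _ :=
  Measure_isProbability.Build _ _ _ circle_measure circle_measureT.

(* distance to 0 in R/Z *)
Definition circle_norm (x : circle R) : R := Num.min (val x) (1 - val x).

Definition rotation (alpha : R) (x : circle R) : circle R := x + to_circle alpha.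

End circle.

Definition measure_preserving d (Y : measurableType d) (R : realType)
    (nu : set Y -> \bar R) (S : Y -> Y) : Prop :=
  measurable_fun [set: Y] S /\
  forall A, measurable A -> nu (S @^-1` A) = nu A.

Definition ergodic d (Y : measurableType d) (R : realType)
    (nu : set Y -> \bar R) (S : Y -> Y) : Prop :=
  measure_preserving nu S /\
  forall A, measurable A -> S @^-1` A = A -> nu A = 0%E \/ nu (~` A) = 0%E.

Definition skew_product (X : Type) (G : zmodType) (T : X -> X) (phi : X -> G)
  (z : X * G) : X * G := (T z.1, z.2 + phi z.1).

(* [T'] is meant to be the inverse of [T]. *)
Section cocycles.
Context d (X : measurableType d) (R : realType).
Variables (mu : probability X R) (T T' : X -> X).

Definition iterz (n : int) : X -> X :=
  match n with Posz m => iter m T | Negz m => iter m.+1 T' end.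

(* For n < 0 this is the value forced by
   T_phi^n (x, g) = (T^n x, g + phi_n(x)), i.e. phi_{-m}(x) = - phi_m(T^{-m} x). *)
Definition cocycle_sum (phi : X -> int) (n : int) (x : X) : int :=
  match n with
  | Posz m => \sum_(j < m) phi (iter j T x)
  | Negz m => - \sum_(j < m.+1) phi (iter j T (iter m.+1 T' x))
  end.

Definition essential_values (phi : X -> int) : set int :=
  [set a | forall V, nbhs a V -> forall B, measurable B -> (0 < mu B)%E ->
    exists n : int,
      (0 < mu (B `&` iterz n @^-1` B `&` [set x | V (cocycle_sum phi n x)]))%E].

(* Haar measure of a subgroup E of Z, seen as a measure on Z carried by E. *)
Definition haar (E : set int) : set int -> \bar R :=
  mrestr (@counting int R) (measurable_int E).

(* For E-valued psi, X * E is invariant under the skew product on X * Z, and has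
   full measure for mu \x haar E; so the last clause is the ergodicity of the
   skew product on X * E. *)
Definition regular_cocycle (phi : X -> int) : Prop :=
  exists eta psi : X -> int,
    [/\ measurable_fun [set: X] eta,
        measurable_fun [set: X] psi,
        {ae mu, forall x, psi x = phi x + eta x - eta (T x)},
        forall x, essential_values phi (psi x) &
        ergodic (mu \x haar (essential_values phi))%E (skew_product T psi)].

End cocycles.

Section continued_fraction.
Variable R : realType.
Implicit Type alpha : R.

(* meant for an irrational alpha in (0, 1) *)
Definition gauss (x : R) : R := x^-1 - (Num.floor x^-1)%:~R.

(* a_0 = 0, and a_n = floor (1 / gauss^(n-1) alpha) for n >= 1 *)
Definition cf_quot alpha (n : nat) : nat :=
  if n is m.+1 then Num.truncn (iter m gauss alpha)^-1 else 0%N.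

Fixpoint cf_den alpha (n : nat) : nat :=
  if n is m.+1 then
    (cf_quot alpha n * cf_den alpha m + (if m is k.+1 then cf_den alpha k else 0))%N
  else 1%N.

Definition bounded_type alpha : Prop :=
  exists M : nat, forall n : nat, (0 < n)%N -> (cf_quot alpha n <= M)%N.

Definition H_set (r alpha : R) : set (circle R) :=
  [set beta | exists b : nat -> int,
    (\sum_(1 <= j <oo) (`|(b j)%:~R : R| `^ r / (cf_quot alpha j.+1)%:R)%:E
       < +oo)%E /\
    circle_norm (to_circle (\sum_(1 <= j < n.+1)
      (b j)%:~R * (cf_den alpha j)%:R * alpha) - beta) @[n --> \oo] --> (0 : R)].

End continued_fraction.

Definition step_cocycle (R : realType) (beta : circle R) (gamma : R) (x : circle R)
    : int :=
  let I := [set y : circle R | val y <= val beta] in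
  \1_I x - \1_I (x + to_circle gamma).

(* Main.v *)
Require Import Defs.
From HB Require Import structures.
From mathcomp Require Import all_boot all_order all_algebra.
From mathcomp Require Import finmap.
From mathcomp Require Import all_classical all_reals all_analysis.
From mathcomp Require Import measurable_realfun.
From mathcomp Require Import ring lra zify.

Set Implicit Arguments.
Unset Strict Implicit.
Unset Printing Implicit Defensive.

Import Order.TTheory GRing.Theory Num.Theory.
Import numFieldNormedType.Exports.

Local Open Scope classical_set_scope.
Local Open Scope ring_scope.

(** Choose indices [n k] along which the partial quotients of [alpha] are huge, and
    let [q k] be the denominators of the corresponding convergents, [dl k] the
    distance from [q k * alpha] to the integers. Put
    [beta = \sum_k b k * dl k] with multipliers [b k] that are small compared with
    the partial quotients; then [beta] belongs to H_1, since [b k * dl k] is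
    [+- b k * q k * alpha] modulo 1.

    The cocycle is the difference of the indicator of [0, beta] at x and at
    x + gamma. The difference of an arc of length c seen from x and from
    x + gamma is also the difference of an arc of length gamma seen from x - c and
    from x ([arc_exchange]). For c = b q alpha modulo 1 this is telescoped by the
    sum of the indicator of that arc over an orbit segment of length b q: every
    stage of the construction is a coboundary with an explicit integer transfer
    function [transfer k]. Since the segment consists of b translates of a segment
    of length q by tiny multiples of [dl k], the transfer function is b times an
    integer outside a small set ([ksum_block]), and that integer is within 3 of a
    constant by a Denjoy-Koksma estimate ([visits_discrepancy]).

    Finite quotients. At a time [c k * q k], where c k * dl k is about 1 / (16 q k),
    the earlier stages have not moved, the later ones have not been met, and stage
    [k] has jumped by exactly [b k] on a tower of measure at least 1/32
    ([small_no_jump]), provided that [q k * gamma] is not within 1/4 of an integer;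
    for almost every gamma this holds for infinitely many [k]
    ([null_not_separated]). As the rotation by [c k * q k * alpha] tends to the
    identity and [b k] is 1 modulo [a], the fibres of an invariant set of the
    quotient modulo [a] are invariant under translation by 1, and ergodicity of the
    rotation concludes ([quotient_ergodic]).

    Non-regularity. The [b k] are moreover chosen such that [b k * alpha] is within
    2^-k of an integer. Multiplied by [alpha], the transfer functions therefore
    become, modulo 1 and up to constants, a convergent series: [alpha] times the
    cocycle is a coboundary modulo 1. A regular cocycle with a nonzero essential
    value [a] would make the fibre coordinates 0 and [a] indistinguishable, hence
    [alpha * a] an integer; a regular cocycle with 0 as only essential value is a
    coboundary, which ergodicity modulo 2 excludes ([not_regular]). *)

(** * Irrational numbers and their convergents *)
Section ContinuedFractions.
Variable R : realType.
Implicit Types alpha x : R.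

Lemma irrational_intM alpha (a p : int) :
  irrational alpha -> a != 0 -> a%:~R * alpha != p%:~R.
Proof.
move=> irr a0; apply/negP => /eqP e; apply: irr.
exists (p%:~R / a%:~R) => //.
by rewrite fmorph_div/= !ratr_int -e mulrC mulKf // intr_eq0.
Qed.

Lemma irrationalP alpha :
  (forall a p : int, a != 0 -> a%:~R * alpha != p%:~R) -> irrational alpha.
Proof.
move=> h [r _ e]; have := h (denq r) (numq r); rewrite denq_eq0 => /(_ isT)/negP.
apply; rewrite -e -[r in ratr r]divq_num_den fmorph_div/= !ratr_int.
by rewrite mulrCA mulfV ?mulr1 // intr_eq0 denq_eq0.
Qed.

Lemma irrational_natM alpha (n : nat) :
  irrational alpha -> (0 < n)%N -> irrational (n%:R * alpha).
Proof.
move=> irr n0; apply: irrationalP => a p a0.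
have := @irrational_intM alpha (a * n%:Z) p irr; rewrite intrM -pmulrn mulrA.
by apply; rewrite mulf_neq0 // -lt0n.
Qed.

Lemma irrational_subint alpha (n : int) :
  irrational alpha -> irrational (alpha - n%:~R).
Proof.
move=> irr; apply: irrationalP => a p a0; rewrite mulrBr subr_eq -intrM -intrD.
exact: irrational_intM.
Qed.

Lemma gauss_irrational x : irrational x -> irrational (gauss x).
Proof.
move=> irr; apply: irrational_subint; apply: irrationalP => a p a0.
apply/negP => /eqP e.
have [x0|x0] := eqVneq x 0.
  by have := @irrational_intM x 1 0 irr isT; rewrite x0 mulr0 eqxx.
have := @irrational_intM x p a irr; rewrite -e mulfVK // eqxx => /(_ _)/negP; apply => //.
by rewrite -(intr_eq0 R) -e mulf_neq0 ?invr_eq0 ?intr_eq0.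
Qed.

Lemma irrational_neq0 x : irrational x -> x != 0.
Proof.
by move=> irr; have := @irrational_intM x 1 0 irr isT; rewrite mul1r.
Qed.

Lemma gauss_itv x : irrational x -> 0 < gauss x < 1.
Proof.
move=> irr; have /irrational_neq0 := gauss_irrational irr.
rewrite /gauss; have /andP[h1 h2] := floor_itv x^-1.
rewrite lt_def subr_ge0 h1 andbT => -> /=.
by rewrite ltrBlDl -intrD1.
Qed.

(** The gap by which a nonzero essential value, multiplied by [alpha], is seen
    modulo 1. *)
Lemma irrational_gap alpha (a : int) : irrational alpha -> a != 0 ->
  exists2 e : R, 0 < e & forall P : int, e <= `|alpha * a%:~R - P%:~R|.
Proof.
move=> irr a0; pose f := alpha * a%:~R - (Num.floor (alpha * a%:~R))%:~R.
have ne (P : int) : alpha * a%:~R != P%:~R by rewrite mulrC; exact: irrational_intM.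
have f0 : 0 < f.
  by rewrite subr_gt0 lt_neqAle eq_sym ne ge_floor.
have f1 : f < 1 by rewrite /f; have := floorD1_gt (alpha * a%:~R); rewrite intrD; lra.
exists (Num.min f (1 - f)); first by rewrite lt_min f0 subr_gt0.
move=> P; rewrite leNgt; apply/negP => h.
have : `|(Num.floor (alpha * a%:~R))%:~R - P%:~R : R| < 1 + f.
  have -> : (Num.floor (alpha * a%:~R))%:~R - P%:~R = alpha * a%:~R - P%:~R - f :> R.
    by rewrite /f; lra.
  apply: le_lt_trans (ler_normB _ _) _; rewrite (gtr0_norm f0) ltrD2r.
  by apply: lt_le_trans h _; rewrite ge_min (ltW f1).
move=> _.
have [hP|hP] := leP P (Num.floor (alpha * a%:~R)).
  have : P%:~R <= (Num.floor (alpha * a%:~R))%:~R :> R by rewrite ler_int.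
  move: h; rewrite lt_min => /andP[h _] hp; move: h.
  by rewrite ger0_norm; rewrite /f; have := ge_floor (alpha * a%:~R); lra.
have : (Num.floor (alpha * a%:~R) + 1)%:~R <= P%:~R :> R by rewrite ler_int lezD1.
move: h; rewrite lt_min => /andP[_ h]; rewrite intrD => hp; move: h.
have hl := floorD1_gt (alpha * a%:~R); rewrite intrD in hl.
by rewrite ler0_norm; rewrite /f; lra.
Qed.

Fixpoint cf_num alpha (n : nat) : int :=
  if n is m.+1 then
    (cf_quot alpha n)%:Z * cf_num alpha m + (if m is k.+1 then cf_num alpha k else 1)
  else 0.

Section Convergents.
Variable alpha : R.
Hypotheses (alpha_gt0 : 0 < alpha) (alpha_lt1 : alpha < 1).
Hypothesis alpha_irr : irrational alpha.
Let rem n := iter n (@gauss R) alpha.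
Let q n := cf_den alpha n.
Let p n := cf_num alpha n.
Let a n := cf_quot alpha n.
Let D n : R := (q n)%:R * alpha - (p n)%:~R.

Let rem_irr n : irrational (rem n).
Proof. by elim: n => //= n; exact: gauss_irrational. Qed.

Let rem_itv n : 0 < rem n < 1.
Proof.
case: n => [|n]; first by rewrite /rem/= alpha_gt0.
exact: (gauss_itv (@rem_irr n)).
Qed.

Let remV n : (rem n)^-1 = (a n.+1)%:R + rem n.+1.
Proof.
have /andP[x0 _] := rem_itv n.
rewrite /a /cf_quot -/(rem n) [rem n.+1]/(gauss (rem n)) /gauss.
have i0 : 0 <= (rem n)^-1 by rewrite invr_ge0 ltW.
have : 0 <= Num.floor (rem n)^-1 by rewrite floor_ge0.
by rewrite truncEfloor; case: (Num.floor _) => // k _; rewrite addrC subrK.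
Qed.

Lemma cf_quot_gt0 n : (0 < cf_quot alpha n.+1)%N.
Proof.
have /andP[x0 x1] := rem_itv n.
by rewrite truncn_gt0 invf_cp1 // ltW.
Qed.

(** Since [1 / rem n = a n.+1 + rem n.+1], the recursion of the convergents becomes
    a one-term recursion of their errors, which alternate in sign. *)
Let DS n : D n.+1 = - rem n.+1 * D n.
Proof.
elim: n => [|n IH].
  have /andP[x0 _] := rem_itv 0; have := remV 0; rewrite /= => h.
  rewrite /D /q /p /= !muln1 addn0 mulr0 add0r mulr0z subr0 -[alpha]/(rem 0).
  have -> : (cf_quot alpha 1)%:R = (rem 0)^-1 - rem 1 by rewrite h addrK.
  by rewrite mulrBl mulVf ?gt_eqF //= !mul1r mulNr; ring.
have e : D n.+2 = (a n.+2)%:R * D n.+1 + D n.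
  rewrite /D /q /p [cf_den _ n.+2]/= [cf_num _ n.+2]/= -!/(cf_den _ n.+1) -!/(cf_num _ n.+1).
  rewrite -/(a n.+2) natrD natrM intrD intrM -!pmulrn.
  by rewrite -/(cf_quot _ _) -/(a _); ring.
have /andP[x0 _] := rem_itv n.+1.
have D0 : D n = - (rem n.+1)^-1 * D n.+1.
  by rewrite IH !mulNr mulrN opprK mulKf // gt_eqF.
by rewrite e D0 remV; ring.
Qed.

Let det n : (q n.+1)%:Z * p n - (q n)%:Z * p n.+1 = (-1) ^+ n.+1.
Proof.
elim: n => [|n IH].
  by rewrite /p /q /= !mulr0 !add0r mul1r expr1.
rewrite exprS -IH /p /q [cf_den _ n.+2]/= [cf_num _ n.+2]/=.
by rewrite -!/(cf_den _ n.+1) -!/(cf_num _ n.+1) PoszD PoszM; ring.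
Qed.

Let Dsign n : 0 < (-1) ^+ n * D n.
Proof.
elim: n => [|n IH]; first by rewrite expr0 mul1r /D /q /p /= mul1r subr0.
have /andP[x0 _] := rem_itv n.+1.
have -> : (-1) ^+ n.+1 * D n.+1 = rem n.+1 * ((-1) ^+ n * D n).
  by rewrite DS exprS; ring.
exact: mulr_gt0.
Qed.

Lemma cf_den_gt0 n : (0 < cf_den alpha n)%N.
Proof.
elim: n => // n IH; apply: (@leq_trans (a n.+1 * q n)).
  by rewrite muln_gt0 cf_quot_gt0.
by rewrite /q; case: n {IH} => [|n] /=; exact: leq_addr.
Qed.

Lemma leq_cf_den n : (n <= cf_den alpha n)%N.
Proof.
case: n => // n; elim: n => [|n IH]; first exact: cf_den_gt0.
rewrite [cf_den _ n.+2]/= -!/(cf_den _ n.+1).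
have q0 := cf_den_gt0 n; have a0 := cf_quot_gt0 n.+1.
rewrite -addn1 leq_add // (leq_trans IH) // leq_pmull //.
Qed.

(** The determinant identity is a Bezout relation. Multiplied out, it reads
    [q n.+1 * `|D n| + q n * `|D n.+1| = 1], with two nonnegative terms because the
    errors alternate in sign; this bounds [D n]. *)
Lemma convergentP n : exists p u v : int,
  [/\ u * p + v * (cf_den alpha n)%:Z = 1,
      0 < `|(cf_den alpha n)%:R * alpha - p%:~R| &
      `|(cf_den alpha n)%:R * alpha - p%:~R| *
         ((cf_quot alpha n.+1)%:R * (cf_den alpha n)%:R) <= 1].
Proof.
exists (p n), ((-1) ^+ n.+1 * (q n.+1)%:Z), (- (-1) ^+ n.+1 * p n.+1).
have nD : `|D n| = (-1) ^+ n * D n.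
  by rewrite -[RHS]gtr0_norm // normrM normrX normrN1 expr1n mul1r.
have nDS : `|D n.+1| = (-1) ^+ n.+1 * D n.+1.
  by rewrite -[RHS]gtr0_norm // normrM normrX normrN1 expr1n mul1r.
have sgn2 k : (-1) ^+ k * (-1) ^+ k = 1 :> int by rewrite -exprMn mulrNN mulr1 expr1n.
split.
  transitivity ((-1) ^+ n.+1 * ((q n.+1)%:Z * p n - (q n)%:Z * p n.+1)).
    by rewrite -/(q n); ring.
  by rewrite det sgn2.
  by rewrite -/(q n) -/(D n) nD.
rewrite -/(q n) -/(D n) -/(a n.+1).
have e : (q n.+1)%:R * `|D n| + (q n)%:R * `|D n.+1| = 1.
  rewrite nD nDS exprS.
  have -> : (q n.+1)%:R * ((-1) ^+ n * D n) + (q n)%:R * (-1 * (-1) ^+ n * D n.+1)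
    = (-1) ^+ n.+1 * ((q n.+1)%:R * (p n)%:~R - (q n)%:R * (p n.+1)%:~R).
    by rewrite /D exprS; ring.
  have := congr1 (fun z : int => z%:~R : R) (det n).
  rewrite /= intrB !intrM -!pmulrn => ->.
  by rewrite rmorphXn /= rmorphN1 -exprMn mulrNN mulr1 expr1n.
apply: le_trans (_ : (q n.+1)%:R * `|D n| <= 1); last first.
  by rewrite -[leRHS]e lerDl mulr_ge0.
rewrite mulrC ler_wpM2r // -natrM ler_nat.
by rewrite /q; case: (n) => [|k] /=; exact: leq_addr.
Qed.

End Convergents.

(** Small multiples of an irrational number step through the circle, so its
    multiples come back just above any prescribed position. *)
Lemma natmul_irrational_dense (theta y e : R) : irrational theta -> 0 < e ->
  exists (n : nat) (k : int), 0 <= n%:R * theta - y - k%:~R < e.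
Proof.
move=> irr e0.
pose x := theta - (Num.floor theta)%:~R.
have xirr : irrational x by exact: irrational_subint.
have x01 : 0 < x < 1.
  rewrite /x lt_neqAle eq_sym irrational_neq0 //= subr_ge0 ge_floor /=.
  by rewrite ltrBlDl -intrD1; exact: floorD1_gt.
case/andP: x01 => x0 x1.
pose m := (Num.truncn e^-1).+1.
have [p [u [v [_ D0 Dle]]]] := convergentP x0 x1 xirr m.
set q := cf_den x m in D0 Dle.
have qm : (m <= q)%N := leq_cf_den x0 x1 xirr m.
pose D := q%:R * x - p%:~R.
have De : `|D| < e.
  have h : e^-1 < q%:R.
    by rewrite (lt_le_trans (truncnS_gt _)) // ler_nat.
  have q0 : (0 : R) < q%:R by rewrite (lt_trans _ h) // invr_gt0.
  have : `|D| * q%:R <= 1.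
    apply: le_trans Dle; rewrite ler_wpM2l //; apply: ler_peMl; first exact: ltW.
    by rewrite ler1n cf_quot_gt0.
  rewrite -ler_pdivlMr // mul1r => /le_lt_trans; apply.
  by rewrite -[ltRHS]invrK ltf_pV2 // posrE ?invr_gt0.
have step (n : nat) : (n * q)%:R * theta = n%:R * D + (n%:Z * (p + q%:Z * Num.floor theta))%:~R.
  by rewrite /D /x natrM !(intrM, intrD) -!pmulrn; ring.
have [Dpos|Dneg] := ltP 0 D.
  (* [P] shifts the target by an integer to the side on which the steps go. *)
  pose P := Num.ceil (`|y|).
  pose j := Num.ceil ((y + P%:~R) / D).
  have yP : 0 <= y + P%:~R.
    have := ceil_ge (`|y|); rewrite -/P; have := ler_norm (- y); rewrite normrN; lra.
  have j0 : 0 <= j.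
    by rewrite ceil_ge0 (lt_le_trans _ (divr_ge0 yP (ltW Dpos))) // ltrN10.
  have jE : j%:~R = `|j|%N%:R :> R by rewrite -[in LHS](gez0_abs j0).
  exists (`|j| * q)%N, (`|j|%N%:Z * (p + q%:Z * Num.floor theta) + P).
  rewrite step [in X in _ - X]intrD -jE.
  have := ceil_ge ((y + P%:~R) / D); have := ceilB1_lt ((y + P%:~R) / D); rewrite -/j.
  rewrite ltr_pdivlMr // ler_pdivrMr // intrB mulrBl mul1r.
  rewrite gtr0_norm // in De; move: (_ * _)%:~R => Z h1 h2.
  by apply/andP; split; lra.
have Dn0 : D < 0 by rewrite lt_neqAle Dneg andbT -normr_gt0.
pose E := - D; have E0 : 0 < E by rewrite oppr_gt0.
pose P := Num.floor (- `|y|).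
pose j := Num.floor (- (y + P%:~R) / E).
have yP : 0 <= - (y + P%:~R).
  have := ge_floor (- `|y|); rewrite -/P; have := ler_norm y; lra.
have j0 : 0 <= j by rewrite floor_ge0 divr_ge0 // ltW.
have jE : j%:~R = `|j|%N%:R :> R by rewrite -[in LHS](gez0_abs j0).
exists (`|j| * q)%N, (`|j|%N%:Z * (p + q%:Z * Num.floor theta) + P).
rewrite step [in X in _ - X]intrD -jE.
have := ge_floor (- (y + P%:~R) / E); have := floorD1_gt (- (y + P%:~R) / E); rewrite -/j.
rewrite ltr_pdivrMr // ler_pdivlMr // intrD mulrDl mul1r.
rewrite ltr0_norm // in De; rewrite /E; move: (_ * _)%:~R => Z h1 h2.
by apply/andP; split; lra.
Qed.

End ContinuedFractions.
(** * Geometric weights and choices along a sequence *)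
Section Sequences.
Variable R : realType.
Implicit Types (j k : nat).

Definition decay (k : nat) : R := 2^-1 ^+ k.
Lemma decay_gt0 k : 0 < decay k. Proof. by rewrite exprn_gt0. Qed.
#[local] Hint Resolve decay_gt0 : core.
Lemma decayS k : decay k = 2 * decay k.+1.
Proof. by rewrite /decay exprS mulrA mulfV ?mul1r. Qed.
Lemma decay_le1 k : decay k <= 1.
Proof. by elim: k => [|k IH]; [rewrite /decay expr0|have := decayS k; have := decay_gt0 k.+1; lra]. Qed.
Lemma decayE k : decay k = (2 ^ k)%:R^-1.
Proof. by rewrite /decay natrX exprVn. Qed.
Lemma decayD j k : decay (j + k) = decay j * decay k.
Proof. by rewrite /decay exprD. Qed.

Lemma decay_small (e : R) : 0 < e -> exists K, forall k, (K <= k)%N -> decay k < e.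
Proof.
move=> e0; exists (Num.truncn e^-1) => k Kk.
have wk : decay k * k.+1%:R <= 1.
  elim: k {Kk} => [|k IH]; first by rewrite /decay expr0 mul1r.
  have := decayS k; have := decay_gt0 k.+1.
  have : decay k.+1 * k.+2%:R <= decay k * k.+1%:R.
    have h2 : k.+2%:R <= 2 * k.+1%:R :> R by rewrite -natrM ler_nat; lia.
    by have := ler_wpM2l (ltW (decay_gt0 k.+1)) h2; rewrite (decayS k); lra.
  by move=> h _ _; exact: le_trans IH.
have k0 : (0 : R) < k.+1%:R by rewrite ltr0n.
rewrite -ler_pdivlMr // mul1r in wk; apply: le_lt_trans wk _.
rewrite -[ltRHS]invrK ltf_pV2 ?posrE ?invr_gt0 //.
by apply: lt_le_trans (truncnS_gt _) _; rewrite ler_nat.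
Qed.

Lemma infinitely_often N (f : nat -> 'I_N) :
  exists i, forall M, exists2 n, (M <= n)%N & f n = i.
Proof.
apply: contrapT => /forallNP H.
have /choice[M hM] : forall i, exists M, forall n, (M <= n)%N -> f n <> i.
  move=> i; have /existsNP[M hM] := H i; exists M => n Mn fn.
  by apply: hM; exists n.
pose n := (\max_i M i)%N.
by apply: (hM (f n) n _ erefl); exact: (leq_bigmax (f n)).
Qed.

(** The conditions on a stage only involve the earlier stages through an
    accumulated cost, so the cost is the state of the recursion. *)
Lemma history_choice (F : nat -> nat -> nat) (P : nat -> nat -> nat -> Prop) :
  (forall k S, exists n, P k S n) ->
  exists f : nat -> nat, forall k, P k (\sum_(j < k) F j (f j))%N (f k).
Proof.
move=> H.
have [ch hch] : exists ch : nat -> nat -> nat, forall k S, P k S (ch k S).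
  have /choice[g hg] : forall kS : nat * nat, exists n, P kS.1 kS.2 n.
    by move=> [k S]; exact: H.
  by exists (fun k S => g (k, S)) => k S; exact: hg (k, S).
pose fix st k := if k is j.+1 then (st j + F j (ch j (st j)))%N else 0%N.
exists (fun k => ch k (st k)) => k.
suff -> : (\sum_(j < k) F j (ch j (st j)))%N = st k by exact: hch.
by elim: k => [|k IH]; rewrite ?big_ord0 // big_ord_recr /= IH.
Qed.

End Sequences.

(** * Lebesgue measure on the circle *)
Section CircleMeasure.
Variable R : realType.
Local Notation circle := (circle R).
Local Notation mu := (@circle_measure R).
Implicit Types (x y c : circle) (A B P : set circle).

(** The image of Lebesgue measure under a translation has the same values on
    intervals. *)
Lemma lebesgue_measure_shift (c : R) (A : set (measurableTypeR R)) :
  measurable A -> lebesgue_measure [set x : R | A (x + c)] = lebesgue_measure A.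
Proof.
move=> mA.
have mf : measurable_fun setT
    (fun x : measurableTypeR R => x + c : measurableTypeR R).
  by apply: measurable_funD => //; exact: measurable_cst.
symmetry; pose f := (fun x : measurableTypeR R => x + c : measurableTypeR R).
transitivity (pushforward lebesgue_measure f A); last by [].
unshelve refine (lebesgue_measure_unique (mu := pushforward lebesgue_measure f) _ mA) => //.
move=> _ [[a b] _ <-] /=; rewrite /pushforward.
have -> : f @^-1` `]a, b] = `](a - c), (b - c)]%classic.
  by apply/seteqP; split => x /=; rewrite !in_itv /= ltrBlDr lerBrDr.
by rewrite !lebesgue_measure_itv /= !lte_fin ltrD2r -!EFinB opprD addrACA subrr addr0.
Qed.

Lemma to_circleB (a b : R) : to_circle (a - b) = to_circle a - to_circle b.
Proof. by apply/(addIr (to_circle b)); rewrite -to_circleD !subrK. Qed.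

Lemma to_circle0 : to_circle (0 : R) = 0.
Proof. by []. Qed.

Lemma to_circleN (a : R) : to_circle (- a) = - to_circle a.
Proof. by rewrite -sub0r to_circleB to_circle0 sub0r. Qed.

Lemma to_circleMn (a : R) n : to_circle (n%:R * a) = to_circle a *+ n.
Proof.
elim: n => [|n IH]; first by rewrite mul0r.
by rewrite [RHS]mulrS -IH -to_circleD -nat1r mulrDl mul1r.
Qed.

Lemma val_itv x : 0 <= val x < 1.
Proof. exact: valP x. Qed.

Lemma val_to_circle (a : R) : 0 <= a < 1 -> val (to_circle a) = a.
Proof. by move=> h; rewrite /= (@floor_def _ _ 0) ?subr0 // add0r. Qed.

Lemma val_to_circleE (a : R) (n : int) :
  0 <= a - n%:~R < 1 -> val (to_circle a) = a - n%:~R.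
Proof.
by move=> h; rewrite -[in LHS](subrK n%:~R a) to_circleDz val_to_circle.
Qed.

Lemma to_circle_eqP (a b : R) :
  to_circle a = to_circle b <-> exists n : int, a - b = n%:~R.
Proof.
split=> [/(congr1 val) /= h|[n e]].
  by exists (Num.floor a - Num.floor b); rewrite intrB; lra.
by rewrite -(subrK b a) e addrC to_circleDz.
Qed.

(** The indicator of [0, r) is integer valued because it enters the cocycle, whose
    transfer functions must be integer valued as well. *)
Definition arc (r : R) (x : circle) : int := Posz (val x < r)%R.

(** Translating by [- c] lowers the representative in [0, 1) by [val c], except
    on [0, c), where it wraps around. *)
Lemma arcE c x : (arc (val c) x)%:~R = val c - val x + val (x - c).
Proof.
have /andP[c0 c1] := val_itv c; have /andP[x0 x1] := val_itv x.
have -> : x - c = to_circle (val x - val c) by rewrite to_circleB !to_circleK.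
rewrite /arc.
case: ltP => h.
  by rewrite (@val_to_circleE _ (-1)) ?mulrN1z; [rewrite mulr1z; lra|apply/andP; split; lra].
by rewrite val_to_circle; [rewrite mulr0z; lra|apply/andP; split; lra].
Qed.

(** By [arcE] both sides are the same alternating sum of four representatives:
    lengths and translations of arcs play symmetric parts. *)
Lemma arc_exchange c g x :
  arc (val c) x - arc (val c) (x + g) =
  arc (val g) (x + g - c) - arc (val g) (x + g).
Proof.
apply: (mulrIz (oner_neq0 R)); rewrite !intrB !arcE.
have -> : x + g - c - g = x - c by rewrite addrAC addrK.
by rewrite addrK; lra.
Qed.

Lemma measurable_circle_val : measurable_fun setT (@circle_val R).
Proof. by move=> _ B mB; exists B => //; rewrite setTI. Qed.

Lemma measurable_arc (r : R) : measurable [set x : circle | val x < r].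
Proof.
have := measurable_circle_val measurableT (measurable_itv `]-oo, r[).
by rewrite setTI; congr measurable; apply/seteqP; split => x /=; rewrite in_itv.
Qed.

Lemma measurable_addc : measurable_fun setT (fun z : circle * circle => z.1 + z.2).
Proof.
have -> : (fun z : circle * circle => z.1 + z.2) =
    @to_circle R \o (fun z => circle_val z.1 + circle_val z.2).
  by apply/funext => z /=; rewrite to_circleD !to_circleK.
apply: measurableT_comp; first exact: measurable_to_circle.
apply: measurable_funD.
  exact: measurableT_comp measurable_circle_val measurable_fst.
exact: measurableT_comp measurable_circle_val measurable_snd.
Qed.

Lemma measurable_shiftc c : measurable_fun setT (fun x => x + c).
Proof.
have -> : (fun x => x + c) = (fun z => z.1 + z.2) \o (fun x => (x, c)) by [].
apply: measurableT_comp; first exact: measurable_addc.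
by apply: measurable_fun_pair => //; exact: measurable_cst.
Qed.

Lemma measurable_shift_set c A : measurable A -> measurable [set x | A (x + c)].
Proof. by move=> mA; rewrite -[X in measurable X]setTI; exact: measurable_shiftc. Qed.

Lemma circle_measureE A :
  mu A = lebesgue_measure
    (((@to_circle R : measurableTypeR R -> circle) @^-1` A) `&` `[0%R, 1%R[).
Proof. by []. Qed.

(** On the line the translate of the fundamental interval sticks out beyond 1; the
    part that sticks out comes back to its beginning by periodicity. *)
Lemma circle_measure_shift c A :
  measurable A -> mu [set x | A (x + c)] = mu A.
Proof.
move=> mA; rewrite !circle_measureE.
set L := (@to_circle R : measurableTypeR R -> circle) @^-1` A.
have mL : measurable L.
  by rewrite -[X in measurable X]setTI; exact: measurable_to_circle.
pose t := val c; have /andP[t0 t1] : 0 <= t < 1 := val_itv c.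
have -> : (@to_circle R : measurableTypeR R -> circle) @^-1` [set x | A (x + c)]
    `&` `[0%R, 1%R[ =
    [set y | (L `&` `[t, 1 + t[) (y + t)].
  apply/seteqP; split => y /=; rewrite !in_itv /= lerDr ltrD2r.
    by move=> -[h ->]; split => //; rewrite /L /= to_circleD to_circleK.
  by move=> -[h ->]; split => //; rewrite /L /= to_circleD to_circleK in h.
rewrite lebesgue_measure_shift; last exact: measurableI.
have split_itv (a b d : R) : a <= b -> b <= d ->
    lebesgue_measure (L `&` `[a, d[) =
    (lebesgue_measure (L `&` `[a, b[) + lebesgue_measure (L `&` `[b, d[))%E.
  move=> ab bd; rewrite -measureU; try exact: measurableI.
    congr lebesgue_measure; rewrite -setIUr; congr setI.
    apply/seteqP; split => y /=; rewrite !in_itv /=.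
      by move=> /andP[h1 h2]; case: (ltP y b) => h; [left|right]; rewrite ?h1 ?h2.
    move=> [] /andP[h1 h2]; rewrite ?h1 ?h2 ?andbT /=.
      exact: lt_le_trans bd.
    exact: le_trans h1.
  apply/seteqP; split => y //= -[[_ +] [_ +]]; rewrite !in_itv /=.
  by move=> /andP[_ h1] /andP[]; rewrite leNgt h1.
have t1t : 1 <= 1 + t by rewrite lerDl.
rewrite (split_itv t 1 (1 + t) (ltW t1) t1t).
rewrite (split_itv 0 t 1 t0 (ltW t1)) addeC; congr (_ + _)%E.
have period (y : R) : to_circle (y + 1) = to_circle y := to_circleDz y 1.
rewrite -(@lebesgue_measure_shift 1 (L `&` `[1, 1 + t[)); last exact: measurableI.
congr lebesgue_measure; apply/seteqP; split => y /=;
  rewrite !in_itv /= /L /= (addrC 1) lerDr ltrD2r;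
  by rewrite period.
Qed.

(** Exceptional sets are known through the sets that cover them, so their size is
    measured from outside. *)
Definition small (e : R) P :=
  exists2 B, measurable B & P `<=` B /\ (mu B <= e%:E)%E.

Lemma small_sub e P Q : P `<=` Q -> small e Q -> small e P.
Proof.
by move=> PQ [B mB [QB Be]]; exists B => //; split => //; exact: subset_trans QB.
Qed.

Lemma small_le e e' P : e <= e' -> small e P -> small e' P.
Proof.
move=> ee' [B mB [PB Be]]; exists B => //; split => //.
by rewrite (le_trans Be) // lee_fin.
Qed.

Lemma small_measure e A : measurable A -> (mu A <= e%:E)%E -> small e A.
Proof. by move=> mA Ae; exists A => //; split. Qed.

Lemma measure_small e A : measurable A -> small e A -> (mu A <= e%:E)%E.
Proof.
move=> mA [B mB [AB Be]]; apply: le_trans Be.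
by apply: le_measure => //; rewrite inE.
Qed.

Lemma smallU e e' P Q : small e P -> small e' Q -> small (e + e') (P `|` Q).
Proof.
move=> [B mB [PB Be]] [C mC [QC Ce]]; exists (B `|` C); first exact: measurableU.
split; first exact: setUSS.
by apply: le_trans (measureU2 _ mB mC) _; rewrite EFinD leeD.
Qed.

Lemma small_shift c e P : small e P -> small e [set x | P (x + c)].
Proof.
move=> [B mB [PB Be]]; exists [set x | B (x + c)]; first exact: measurable_shift_set.
by split => [x /PB //|]; rewrite circle_measure_shift.
Qed.

Lemma circle_measure_arc (r : R) : 0 <= r <= 1 -> mu [set x | val x < r] = r%:E.
Proof.
move=> /andP[r0 r1]; rewrite circle_measureE.
have -> : (@to_circle R : measurableTypeR R -> circle) @^-1` [set x | val x < r]
    `&` `[0%R, 1%R[ =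
    `[0%R, r[%classic.
  apply/seteqP; split => y.
    move=> [+]; rewrite /= !in_itv => + y01; rewrite -[X in X < r]/(val (to_circle y)).
    by rewrite val_to_circle //= => ->; move/andP: y01 => /= [-> _].
  rewrite /= !in_itv /= => /andP[y0 yr]; have y1 : y < 1 by exact: lt_le_trans r1.
  split; last by rewrite /= y0 y1.
  by rewrite -[X in X < r]/(val (to_circle y)) val_to_circle // y0.
rewrite lebesgue_measure_itv /= lte_fin; case: ltP => h; rewrite ?sube0 //.
by congr EFin; apply/eqP; rewrite eq_le r0.
Qed.

Lemma small_arc (r : R) : 0 <= r -> small r [set x | val x < r].
Proof.
move=> r0; apply: small_measure; first exact: measurable_arc.
have [r1|r1] := leP r 1; first by rewrite circle_measure_arc ?r0.
by apply: (le_trans (probability_le1 _ (measurable_arc r))); rewrite lee_fin ltW.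
Qed.

Lemma smallT : ~ small 0 setT.
Proof.
move=> [B mB [TB]]; have -> : B = setT by apply/seteqP; split.
by rewrite probability_setT lee_fin ler10.
Qed.

Lemma small_exists e P : small e P -> e < 1 -> exists x, ~ P x.
Proof.
move=> [B mB [PB Be]] e1; apply: contrapT => /forallNP h.
have BT : B = setT.
  by apply/seteqP; split => // x _; apply: PB; apply: contrapT; exact: h.
by move: Be; rewrite BT probability_setT lee_fin leNgt e1.
Qed.

Lemma small_set0 : small 0 set0.
Proof. by apply: small_measure => //; rewrite measure0. Qed.

Lemma small_bigU n (e : nat -> R) (P : nat -> set circle) :
  (forall i, (i < n)%N -> small (e i) (P i)) ->
  small (\sum_(i < n) e i) [set x | exists2 i, (i < n)%N & P i x].
Proof.
elim: n => [|n IH] h.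
  by rewrite big_ord0; apply: small_sub small_set0 => x [].
rewrite big_ord_recr /=.
apply: small_sub (smallU (IH _) (h n (ltnSn n))).
  move=> x [i]; rewrite ltnS leq_eqVlt => /predU1P[->|ilt]; first by right.
  by left; exists i.
by move=> i ilt; apply: h; exact: ltnW.
Qed.

Lemma small_cup e (P : nat -> set circle) :
  (forall k, small (e / (2 ^ k.+1)%:R) (P k)) -> small e (\bigcup_k P k).
Proof.
move=> h.
have h' k := cid2 (h k).
pose B k := projT1 (h' k).
have mB k : measurable (B k) by rewrite /B; case: (h' k).
have PB k : P k `<=` B k by rewrite /B; case: (h' k) => ? /= _ [].
have Be k : (mu (B k) <= (e / (2 ^ k.+1)%:R)%:E)%E by rewrite /B; case: (h' k) => ? /= _ [].
exists (\bigcup_k B k); first exact: bigcup_measurable.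
split; first by apply: subset_bigcup => k _; exact: PB.
have e0 : 0 <= e.
  have := le_trans (measure_ge0 mu (B 0%N)) (Be 0%N).
  by rewrite lee_fin pmulr_lge0 // invr_gt0 ltr0n.
apply: le_trans (epsilon_trick0 xpredT e0).
apply: (le_trans (measure_sigma_subadditive mu mB _ _)) => //.
  exact: bigcup_measurable.
by apply: lee_nneseries => [k _ _|k _]; [exact: measure_ge0|exact: Be].
Qed.

Lemma null_cup (P : nat -> set circle) :
  (forall k, small 0 (P k)) -> small 0 (\bigcup_k P k).
Proof. by move=> h; apply: small_cup => k; rewrite mul0r. Qed.

Lemma null_point a : small 0 [set a].
Proof.
apply: small_measure; last first.
  rewrite circle_measureE (_ : _ `&` _ = [set val a]) ?lebesgue_measure_set1 //.
  apply/seteqP; split => y /=; rewrite in_itv /=.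
    by move=> -[<- h]; rewrite -[RHS]/(val (to_circle y)) val_to_circle.
  by move=> ->; split; [exact: to_circleK|exact: val_itv].
exists [set val a] => //; rewrite setTI.
by apply/seteqP; split => y /=; [move/val_inj|move->].
Qed.

Lemma null_smallP A : measurable A -> (forall e, 0 < e -> small e A) -> mu A = 0%E.
Proof.
move=> mA h; apply/eqP; rewrite eq_le measure_ge0 andbT.
apply/lee_addgt0Pr => e e0; rewrite add0e; exact: measure_small (h _ e0).
Qed.

End CircleMeasure.
(** * Translations and ergodicity of the rotation *)
Section RotationErgodic.
Variable R : realType.
Local Notation circle := (circle R).
Local Notation mu := (@circle_measure R).
Implicit Types (x y c : circle) (A B P : set circle).

(** Open rays generate the Borel sets of the line, hence the arcs [0, r) those of
    the circle. *)
Lemma circle_measurable_ind (K : set (set circle)) :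
  K set0 -> (forall A, K A -> K (~` A)) ->
  (forall F : nat -> set circle, (forall n, K (F n)) -> K (\bigcup_n F n)) ->
  (forall r : R, K [set x | val x < r]) ->
  forall A, measurable A -> K A.
Proof.
move=> K0 KC KU Karc _ [B mB <-]; rewrite setTI.
have : (@RGenInftyO.G R).-sigma.-measurable B by rewrite -RGenInftyO.measurableE.
pose K' (C : set R) := K (@circle_val R @^-1` C).
have sub : (@RGenInftyO.G R).-sigma.-measurable `<=` K'; last exact: sub.
apply: smallest_sub.
  split.
  - by rewrite /K' preimage_set0.
  - by move=> C; rewrite /K' setTD preimage_setC; exact: KC.
  - by move=> F KF; rewrite /K' preimage_bigcup; exact: KU.
move=> _ [r ->]; have := Karc r; rewrite /K'; congr K.
Qed.

(** Continuity of translations in L1: it suffices to know it for arcs, since the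
    sets with this property form a sigma-algebra. *)
Lemma shift_continuous A (e : R) : measurable A -> 0 < e ->
  exists2 h : R, 0 < h & forall c, val c < h ->
    small e [set x | ~ (A x <-> A (x + c))].
Proof.
move=> mA; pose cont A := forall e : R, 0 < e -> exists2 h : R, 0 < h &
  forall c, val c < h -> small e [set x | ~ (A x <-> A (x + c))].
suff : measurable A /\ cont A by move=> [_]; exact.
clear e; move: A mA; apply: circle_measurable_ind.
- split=> // e e0; exists 1 => // c _; apply: small_le (ltW e0) _.
  by apply: small_sub (small_set0 R) => x /= [].
- move=> A [mA cA]; split; first exact: measurableC.
  move=> e e0; have [h h0 hA] := cA _ e0; exists h => // c ch.
  by apply: small_sub (hA c ch) => x /= H [H1 H2]; apply: H; split; tauto.
- move=> F KF; split; first by apply: bigcup_measurable => n _; case: (KF n).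
  have finite M : cont (\bigcup_(i in `I_M) F i).
    elim: M => [|M IH] e e0.
      exists 1 => // c _; apply: small_le (ltW e0) _.
      by apply: small_sub (small_set0 R) => x /= []; rewrite II0 !bigcup_set0.
    have e20 : 0 < e / 2 by rewrite divr_gt0.
    have [h h0 hA] := IH _ e20; have [h' h'0 hF] := (KF M).2 _ e20.
    exists (Num.min h h'); first by rewrite lt_min h0.
    move=> c; rewrite lt_min => /andP[ch ch'].
    rewrite [e]splitr; apply: small_sub (smallU (hA c ch) (hF c ch')).
    move=> x /= H; apply: contrapT => /not_orP[/contrapT H1 /contrapT H2].
    apply: H; rewrite IIS bigcup_setU bigcup_set1; split=> -[h1|h1].
    + by left; apply/H1.
    + by right; apply/H2.
    + by left; apply/H1.
    + by right; apply/H2.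
  (* All but a small part of the union is in a finite union. *)
  move=> e e0; have e30 : 0 < e / 3 by rewrite divr_gt0.
  pose U := \bigcup_n F n; pose V M := \bigcup_(i in `I_M) F i.
  have mV M : measurable (V M) by apply: bigcup_measurable => i _; case: (KF i).
  have mU : measurable U by apply: bigcup_measurable => i _; case: (KF i).
  have [M rest] : exists M, small (e / 3) (U `\` V M).
    have mUV M : measurable (U `\` V M) by exact: measurableD.
    have cv : mu (U `\` V M) @[M --> \oo] --> mu (\bigcap_M (U `\` V M)).
      apply: nonincreasing_cvg_mu => //.
      - by rewrite (le_lt_trans (probability_le1 _ (mUV 0%N))) // ltry.
      - by apply: bigcap_measurable => //; exists 0%N.
      - move=> m n mn; apply/subsetPset => x [Ux Vx]; split=> // -[i /= im Fi].
        by apply: Vx; exists i => //=; exact: leq_trans mn.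
    have cap0 : \bigcap_M (U `\` V M) = set0.
      apply/seteqP; split=> // x H; have [[i _ Fi] _] := H 0%N Logic.I.
      by have [_] := H i.+1 Logic.I; apply; exists i => /=.
    rewrite cap0 measure0 in cv.
    have : \forall M \near \oo, (mu (U `\` V M) < (e / 3)%:E)%E.
      apply: (cv [set z | (z < (e / 3)%:E)%E]); apply: open_nbhs_nbhs.
      by split; [exact: open_ereal_lt_ereal|rewrite /= lte_fin].
    case=> M _ /(_ M (leqnn M)) /= H; exists M.
    by apply: small_measure => //; exact: ltW.
  have [h h0 hV] := finite M _ e30; exists h => // c ch.
  have -> : e = e / 3 + (e / 3 + e / 3) by field.
  apply: small_sub (smallU (hV c ch) (smallU rest (small_shift c rest))).
  have VU y : V M y -> U y by case=> i _ Fi; exists i.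
  move=> x /= H; apply: contrapT => /not_orP[/contrapT H1 /not_orP[H2 H3]].
  apply: H; split=> Hx; apply: contrapT => Hc.
    by apply: H2; split=> // /H1 /VU.
  by apply: H3; split=> // /H1 /VU.
- move=> r; split; first exact: measurable_arc.
  have triv (P : Prop) (e : R) : P -> 0 < e ->
      exists2 h : R, 0 < h & forall c, val c < h -> small e [set x : circle | ~ P].
    move=> p e0; exists 1 => // c _; apply: small_le (ltW e0) _.
    exact: small_sub (small_set0 R).
  (* The indicator of [0, r) can only change where [arc_exchange] sees the two
     ends of the arc. *)
  move=> e e0.
  have [r0|r0] := leP r 0.
    exists 1 => // c _; apply: small_le (ltW e0) _; apply: small_sub (small_set0 R).
    move=> x /=; apply; have /andP[x0 _] := val_itv x; have /andP[y0 _] := val_itv (x + c).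
    by rewrite !ltNge (le_trans r0 x0) (le_trans r0 y0).
  have [r1|r1] := leP 1 r.
    exists 1 => // c _; apply: small_le (ltW e0) _; apply: small_sub (small_set0 R).
    move=> x /=; apply; have /andP[_ x1] := val_itv x; have /andP[_ y1] := val_itv (x + c).
    by rewrite (lt_le_trans x1 r1) (lt_le_trans y1 r1).
  exists (e / 2); first by rewrite divr_gt0.
  move=> c ce; have /andP[c0 _] := val_itv c.
  have sc := small_le (ltW ce) (small_arc c0).
  have rE : r = val (to_circle r) by rewrite val_to_circle // ltW.
  rewrite [X in small X]splitr.
  apply: small_sub (smallU (small_shift (c - to_circle r) sc) (small_shift c sc)).
  move=> x /= H; apply: contrapT => /not_orP[/negP H1 /negP H2]; apply: H.
  move: H1 H2 => /negbTE H1 /negbTE H2.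
  have := arc_exchange (to_circle r) c x; rewrite -rE /arc -addrA H1 H2 subrr.
  by move=> /eqP; rewrite subr_eq0; case: (val x < r); case: (val (x + c) < r).
Qed.

Lemma shift_continuous_family n (P : nat -> set circle) (e : R) :
  (forall i, measurable (P i)) -> 0 < e ->
  exists2 h : R, 0 < h & forall c, val c < h ->
    small e [set x | exists2 i, (i < n)%N & ~ (P i x <-> P i (x + c))].
Proof.
move=> mP; elim: n e => [|n IH] e e0.
  exists 1 => // c _; apply: small_le (ltW e0) _.
  by apply: small_sub (small_set0 R) => x [].
have e20 : 0 < e / 2 by rewrite divr_gt0.
have [h h0 hP] := IH _ e20; have [h' h'0 hn] := shift_continuous (mP n) e20.
exists (Num.min h h'); first by rewrite lt_min h0.
move=> c; rewrite lt_min => /andP[ch ch'].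
rewrite [e]splitr; apply: small_sub (smallU (hP c ch) (hn c ch')) => x [i].
by rewrite ltnS leq_eqVlt => /predU1P[->|ilt] H; [right|left; exists i].
Qed.

(** A set invariant under one irrational rotation is, by continuity, invariant
    under all translations; integrating over the translation then gives
    mu A = (mu A)^2. *)
Lemma rotation_invariant_null_or_full (alpha : R) A : irrational alpha ->
  measurable A -> (forall x, A x <-> A (x + to_circle alpha)) ->
  mu A = 0%E \/ mu (~` A) = 0%E.
Proof.
move=> irr mA invA.
have invn n x : A x <-> A (x + to_circle alpha *+ n).
  elim: n => [|n IH]; first by rewrite mulr0n addr0.
  by rewrite mulrSr addrA -invA.
have invt t (e : R) : 0 < e -> small e [set x | ~ (A x <-> A (x + t))].
  move=> e0; have [h h0 hA] := shift_continuous mA e0.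
  have [n [k /andP[k0 kh]]] := natmul_irrational_dense (val t)
    irr (e := Num.min h 1) (ltac:(rewrite lt_min h0 ltr01 //)).
  move: kh; rewrite lt_min => /andP[kh k1].
  pose c := to_circle alpha *+ n - t.
  have cE : val c = n%:R * alpha - val t - k%:~R.
    rewrite /c -to_circleMn -[t in LHS]to_circleK -to_circleB.
    by apply: val_to_circleE; rewrite k0 k1.
  have ch : val c < h by rewrite cE.
  apply: small_sub (small_shift t (hA c ch)) => x /= H H'; apply: H.
  rewrite /= in H'; rewrite H' (_ : x + t + c = x + to_circle alpha *+ n).
    exact: invn.
  by rewrite /c -addrA [t + _]addrC subrK.
have mAt t : measurable (A `&` [set x | A (x + t)]).
  by apply: measurableI => //; exact: measurable_shift_set.
have measAt t : mu (A `&` [set x | A (x + t)]) = mu A.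
  apply/eqP; rewrite eq_le; apply/andP; split.
    by apply: le_measure; rewrite ?inE // => x [].
  apply/lee_addgt0Pr => e e0.
  have h := measure_small _ (small_sub _ (invt t e e0)).
  apply: le_trans (leeD (lexx _) (h (A `\` [set x | A (x + t)]) _ _)).
  - rewrite -measureU //; last 2 first.
    + by apply: measurableD => //; exact: measurable_shift_set.
    + by apply/seteqP; split => x // -[[_ H1] [_ H2]].
    apply: le_measure; rewrite ?inE //.
      by apply: measurableU => //; apply: measurableD => //; exact: measurable_shift_set.
    by move=> x Ax; case: (pselect (A (x + t))) => H; [left|right].
  - by apply: measurableD => //; exact: measurable_shift_set.
  - by move=> x [Ax H] /= H'; apply: H; rewrite /= -H'.
pose W := [set z : circle * circle | A z.1 /\ A (z.1 + z.2)].
have mW : measurable W.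
  apply: measurableI; rewrite -[X in measurable X]setTI.
    exact: measurable_fst.
  exact: measurable_addc.
(* The sections of [W] in one direction are translates of [A] over the points of
   [A]; in the other direction they all have the measure of [A]. *)
have W1 : (mu \x mu)%E W = (mu A * mu A)%E.
  rewrite /product_measure1.
  transitivity (\int[mu]_x ((mu A) * (\1_A x)%:E))%E.
    apply: eq_integral => x _ /=; rewrite indicE; case: (boolP (x \in A)) => xA.
      rewrite mule1 -(circle_measure_shift x mA); congr (circle_measure _).
      apply/seteqP; split => t; rewrite /xsection /= inE /= addrC.
        by case.
      by move=> ?; split=> //; rewrite inE in xA.
    rewrite mule0 (_ : xsection W x = set0) ?measure0 //.
    apply/seteqP; split => t //; rewrite /xsection /= inE /= => -[Ax _].
    by move/negP: xA; rewrite inE.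
  have fA : mu A \is a fin_num by exact: fin_num_measure.
  rewrite -(fineK fA) integralZl //; last exact: integrable_indic.
  by rewrite integral_indic // setIT fineK.
have W2 : (mu \x mu)%E W = mu A.
  rewrite (product_measure_unique (m' := (mu \x^ mu)%E)) //; last first.
    by move=> B C mB mC; exact: product_measure2E.
  transitivity (\int[mu]_(t in [set: circle]) mu A)%E.
    apply: (@eq_integral _ _ _ mu) => t _ /=; rewrite -[RHS](measAt t); congr (circle_measure _).
    by apply/seteqP; split => x; rewrite /ysection /= inE.
  by move: (mu A) => m; rewrite integral_cst // [X in (_ * X)%E](@probability_setT _ _ _ mu) mule1.
have fA : mu A \is a fin_num by exact: fin_num_measure.
have : fine (mu A) * (1 - fine (mu A)) = 0.
  have := W2; rewrite W1 -(fineK fA) -EFinM => -[h]; rewrite mulrBr mulr1 h subrr //.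
move/eqP; rewrite mulf_eq0 subr_eq0 => /orP[/eqP h|/eqP h]; [left|right].
  by rewrite -(fineK fA) h.
have -> : mu (~` A) = (1 - mu A)%E by exact: probability_setC.
by rewrite -(fineK fA) -h subee.
Qed.

(** The line is covered by countably many translates of [0, 1), on each of which
    the lift of a null set is a translate of that null set. *)
Lemma negligible_lift (N : set circle) : small 0 N ->
  (@lebesgue_measure R).-negligible [set g : R | N (to_circle g)].
Proof.
move=> [B mB [NB B0]].
pose L := (@to_circle R : measurableTypeR R -> circle) @^-1` B.
have mL : measurable L.
  by rewrite -[X in measurable X]setTI; exact: measurable_to_circle.
have L0 : lebesgue_measure (L `&` `[0%R, 1%R[) = 0%E.
  apply/eqP; rewrite eq_le measure_ge0 andbT; exact: B0.
have h : (@lebesgue_measure R).-negligible (\bigcup_(n in [set: int]) (L `&` `[n%:~R, (n + 1)%:~R[)).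
  pose F (k : nat) := \bigcup_(n in [set n : int | choice.pickle n = k]) (L `&` `[n%:~R, (n + 1)%:~R[).
  apply: negligibleS (negligible_bigcup (F := F) _).
    by move=> x [n _ Hx]; exists (choice.pickle n) => //; exists n.
  move=> k; case E : (@pickle_inv int k) => [n|]; last first.
    apply: negligibleS (negligible_set0 _) => x [m /= mk _].
    by move: E; rewrite -mk pickleK_inv.
  apply: negligibleS (_ : _.-negligible (L `&` `[n%:~R, (n + 1)%:~R[)).
    move=> x [m /= mk]; suff -> : m = n by [].
    by move: E; rewrite -mk pickleK_inv => -[].
  exists (L `&` `[n%:~R, (n + 1)%:~R[); split=> //; first exact: measurableI.
  rewrite -[RHS]L0.
  have mLn : measurable (L `&` `[n%:~R, (n + 1)%:~R[) by exact: measurableI.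
  apply: (eq_trans (esym (lebesgue_measure_shift n%:~R mLn))).
  congr lebesgue_measure; apply/seteqP; split => y /=.
    rewrite !in_itv /= /L /= to_circleDz intrD [X in _ < X]addrC.
    by rewrite lerDr ltrD2r.
  rewrite !in_itv /= /L /= to_circleDz intrD [X in _ -> _ /\ (_ <= _ < X)]addrC.
  by rewrite lerDr ltrD2r.
apply: negligibleS h => g /= Ng; exists (Num.floor g) => //; split; first exact: NB.
by rewrite /= in_itv /= floor_itv.
Qed.

End RotationErgodic.

(** * Orbit segments of the length of a convergent denominator *)
Section Stage.
Variable R : realType.
Local Notation circle := (circle R).
Local Notation mu := (@circle_measure R).
Implicit Types (x g c : circle).

Lemma card_int_itv n (N : 'I_n -> int) (S : {set 'I_n}) (a b : R) :
  {in S &, injective N} -> a <= b -> (forall i, i \in S -> a <= (N i)%:~R < b) ->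
  #|S|%:R <= b - a + 1.
Proof.
move=> injN ab NS.
pose m := Num.ceil a.
have ba : 0 <= b - a by rewrite subr_ge0.
pose K := (Num.truncn (b - a)).+1.
have Nm i : i \in S -> 0 <= N i - m.
  by move=> /NS /andP[h _]; rewrite subr_ge0 /m ceil_le_int.
have NK i : i \in S -> (`|N i - m| < K)%N.
  move=> iS; have /andP[_ h] := NS _ iS; rewrite ltnS.
  rewrite truncn_ge_nat // natr_absz ger0_norm ?Nm // intrB.
  by have := ceil_ge a; rewrite -/m; lra.
pose f i : 'I_K := inord `|N i - m|.
have injf : {in S &, injective f}.
  move=> i j iS jS /(congr1 val); rewrite /= !inordK ?NK // => e.
  apply: injN => //; apply: (addIr (- m)).
  by rewrite -(gez0_abs (Nm _ iS)) -(gez0_abs (Nm _ jS)) e.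
have cS : (#|S| <= K)%N.
  by rewrite -(card_in_imset injf) -[leqRHS]card_ord max_card.
have : (#|S|%:R : R) <= K%:R by rewrite ler_nat.
move=> h; apply: le_trans h _; rewrite -natr1 lerD2r.
by have /andP[] := truncn_itv ba.
Qed.

Lemma norm_nat_lt1 (m n : int) : `|m%:~R - n%:~R : R| < 1 -> m = n.
Proof.
rewrite -intrB -intr_norm => h; apply/eqP; rewrite -subr_eq0 -normr_eq0.
by have := h; rewrite -[1]/(1%:~R) ltr_int; have := normr_ge0 (m - n); lia.
Qed.

(** The arc [- g, 0), which [arc_exchange] produces and whose orbit sums are the
    transfer functions. *)
Definition kap (g x : circle) : int := arc (val g) (x + g).

Lemma arc_kap (c g x : circle) :
  arc (val c) x - arc (val c) (x + g) = kap g (x - c) - kap g x.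
Proof. by rewrite arc_exchange /kap addrAC. Qed.

Lemma kap_shift (t : R) g x : 0 <= t < 1 -> t <= val x -> t <= val (x + g) ->
  kap g (x - to_circle t) = kap g x.
Proof.
move=> t01 tx tg; apply/eqP; rewrite -subr_eq0 -arc_kap val_to_circle // /arc.
by rewrite !ltNge tx tg.
Qed.

Lemma subrBD (V : zmodType) (x g a b : V) : x + g - a - (x - b) + (a - b) = g.
Proof.
apply: (addIr (x - b)); rewrite addrAC subrK addrA subrK addrA.
by rewrite (addrC x g).
Qed.

Section Tower.
Variables (th dl : R) (q : nat) (p u v : int).
Hypotheses (q_gt0 : (0 < q)%N) (dl_gt0 : 0 < dl).
Hypothesis thE : q%:R * th = p%:~R + dl.
Hypothesis bezout : u * p + v * q%:Z = 1.
Let d := to_circle th.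

Definition ksum (g : circle) n (x : circle) : int := \sum_(i < n) kap g (x - d *+ i).

Definition visits (r : R) (x : circle) : int := \sum_(i < q) arc r (x - d *+ i).

Let lvl x i : int := - (i%:Z * p) - q%:Z * Num.floor (val x - i%:R * th).

(** The orbit of [x] of length [q] follows the rational rotation by p/q: up to a
    drift smaller than [q * dl], the integer [lvl x i] counts the steps of
    length 1/q. *)
Let lvlE x i : q%:R * val (x - d *+ i) = q%:R * val x - i%:R * dl + (lvl x i)%:~R.
Proof.
have -> : x - d *+ i = to_circle (val x - i%:R * th).
  by rewrite to_circleB to_circleK to_circleMn.
rewrite /= /lvl intrB intrN !intrM -!pmulrn.
have : i%:R * (q%:R * th) = i%:R * (p%:~R + dl) by rewrite thE.
lra.
Qed.

(** By the Bezout relation, multiplication by [p] is injective modulo [q]. *)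
Let lvl_inj x (i j : 'I_q) : lvl x i = lvl x j -> i = j.
Proof.
move=> e.
have dvd : exists k : int, (i%:Z - j%:Z) * p = q%:Z * k.
  exists (Num.floor (val x - j%:R * th) - Num.floor (val x - i%:R * th)).
  by move: e; rewrite /lvl; lia.
case: dvd => k kE.
have e2 : i%:Z - j%:Z = q%:Z * (u * k + v * (i%:Z - j%:Z)).
  rewrite -[LHS]mulr1 -bezout mulrDr mulrCA kE; ring.
apply/val_inj => /=; have := ltn_ord i; have := ltn_ord j.
move: (u * k + _) e2 => z; case: (z =P 0) => [->|z0]; first by lia.
nia.
Qed.

Let drift (i : 'I_q) : 0 <= i%:R * dl < q%:R * dl.
Proof. by rewrite mulr_ge0 // ?ltW //= ltr_pM2r // ltr_nat. Qed.

(** Two visits to [0, r) have levels that differ by less than [q * r + q * dl]. *)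
Lemma visit_unique (r : R) x (i j : 'I_q) : q%:R * r + q%:R * dl <= 1 ->
  val (x - d *+ i) < r -> val (x - d *+ j) < r -> i = j.
Proof.
move=> h hi hj; apply: (@lvl_inj x); apply: norm_nat_lt1.
have q0 : (0 : R) < q%:R by rewrite ltr0n.
have := lvlE x i; have := lvlE x j.
have /andP[i0 i1] := val_itv (x - d *+ i); have /andP[j0 j1] := val_itv (x - d *+ j).
have /andP[di di'] := drift i; have /andP[dj dj'] := drift j.
rewrite -(ltr_pM2l q0) in hi; rewrite -(ltr_pM2l q0) in hj.
have := mulr_ge0 (ltW q0) i0; have := mulr_ge0 (ltW q0) j0.
rewrite ltr_norml; move: (q%:R * val _) (q%:R * val _) (q%:R * val _) hi hj.
move: (lvl x i)%:~R (lvl x j)%:~R (q%:R * r) (q%:R * dl) (i%:R * dl) (j%:R * dl) h di di' dj dj'.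
by move=> *; apply/andP; split; lra.
Qed.

Lemma visitsE (r : R) x : visits r x = #|[set i : 'I_q | val (x - d *+ i) < r]%SET|%:Z.
Proof.
rewrite /visits -(big_morph Posz PoszD erefl) -sum1dep_card [in RHS]big_mkcond /=.
by congr Posz; apply: eq_bigr => i _; case: (_ < _).
Qed.

Lemma visits_eq1 (r : R) x (i : 'I_q) : q%:R * r + q%:R * dl <= 1 ->
  val (x - d *+ i) < r -> visits r x = 1.
Proof.
move=> h hi; rewrite visitsE (_ : [set _ | _]%SET = [set i]%SET) ?cards1 //.
apply/setP => j; rewrite !inE; apply/idP/eqP => [hj|->//].
exact: visit_unique hj hi.
Qed.

(** The Denjoy-Koksma bound: the levels of the visits to [0, r) are distinct
    integers in an interval of length [q * r + q * dl], which bounds their number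
    from above; the complementary arc gives the bound from below. *)
Lemma visits_discrepancy (r : R) x : 0 <= r <= 1 -> q%:R * dl <= 1 ->
  `|(visits r x)%:~R - q%:R * r| <= 2.
Proof.
move=> /andP[r0 r1] qd; rewrite visitsE -pmulrn.
have q0 : (0 : R) < q%:R by rewrite ltr0n.
set S := [set i | _]%SET.
have qr0 : 0 <= q%:R * r by rewrite mulr_ge0 // ltW.
have qr1 : 0 <= q%:R * (1 - r) by rewrite mulr_ge0 ?subr_ge0 // ltW.
have h1 : #|S|%:R <= (q%:R * r - q%:R * val x + q%:R * dl) - (- (q%:R * val x)) + 1.
  apply: (card_int_itv (N := fun i : 'I_q => lvl x i)).
  - by move=> i j _ _; exact: lvl_inj.
  - have := mulr_gt0 q0 dl_gt0; lra.
  - move=> i; rewrite inE => hi; have := lvlE x i; have /andP[di di'] := drift i.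
    have /andP[i0 i1] := val_itv (x - d *+ i); have := mulr_ge0 (ltW q0) i0.
    rewrite -(ltr_pM2l q0) in hi.
    by move=> ? ?; apply/andP; split; lra.
have h2 : #|~: S|%:R <= (q%:R - q%:R * val x + q%:R * dl) - (q%:R * r - q%:R * val x) + 1.
  apply: (card_int_itv (N := fun i : 'I_q => lvl x i)).
  - by move=> i j _ _; exact: lvl_inj.
  - have := mulr_gt0 q0 dl_gt0; lra.
  - move=> i; rewrite !inE -leNgt => hi; have := lvlE x i; have /andP[di di'] := drift i.
    have /andP[i0 i1] := val_itv (x - d *+ i).
    rewrite -(ler_pM2l q0) in hi; rewrite -(ltr_pM2l q0) mulr1 in i1.
    by move=> ?; apply/andP; split; lra.
have := cardsC S; rewrite card_ord => /(congr1 (fun n => n%:R : R)); rewrite natrD => h3.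
by rewrite ler_norml; apply/andP; split; lra.
Qed.

(** Multiplication by [q] brings every visit to [0, r) within [q * r + q * dl] of
    0 on the circle, so that visits from [x] and from [x + g] force [q * g] to be
    close to 0. *)
Lemma visits_separated (r : R) x g (i j : 'I_q) : q%:R * r + q%:R * dl < 1 / 4 ->
  1 / 4 <= val (g *+ q) <= 3 / 4 ->
  val (x - d *+ i) < r -> r <= val (x + g - d *+ j).
Proof.
move=> h /andP[g1 g2] hi; rewrite leNgt; apply/negP => hj.
have q0 : (0 : R) < q%:R by rewrite ltr0n.
pose a := q%:R * val (x - d *+ i); pose b := q%:R * val (x + g - d *+ j).
have /andP[a0 _] := val_itv (x - d *+ i); have /andP[b0 _] := val_itv (x + g - d *+ j).
have {}a0 : 0 <= a by rewrite mulr_ge0 // ltW.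
have {}b0 : 0 <= b by rewrite mulr_ge0 // ltW.
have {}hi : a < q%:R * r by rewrite ltr_pM2l.
have {}hj : b < q%:R * r by rewrite ltr_pM2l.
have /andP[di di'] := drift i; have /andP[dj dj'] := drift j.
have dq : d *+ q = to_circle dl.
  by rewrite -to_circleMn thE addrC to_circleDz.
pose t := b - a + (j%:R * dl - i%:R * dl).
have tE : to_circle t = g *+ q.
  rewrite /t to_circleD !to_circleB !to_circleMn !to_circleK -!dq.
  rewrite ![(_ - _) *+ q]mulrnBl [(x + g) *+ q]mulrnDl -!mulrnA ![(q * _)%N]mulnC.
  exact: subrBD.
have tlt : t < 1 / 4 by rewrite /t; lra.
have tgt : - (1 / 4) < t by rewrite /t; lra.
move: t tE tlt tgt => t tE tlt tgt.
have [t0|t0] := leP 0 t.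
  have tv : val (to_circle t) = t by apply: val_to_circle; apply/andP; split; lra.
  by move: g1; rewrite -tE tv; lra.
have tv : val (to_circle t) = t - (-1)%:~R.
  by apply: val_to_circleE; rewrite mulrN1z; apply/andP; split; lra.
by move: g2; rewrite -tE tv mulrN1z; lra.
Qed.

(** The translates of [0, r) along the orbit segment are disjoint, so they cover
    a set of measure [q * r]. *)
Lemma small_unvisited (r : R) : 0 <= r -> q%:R * r + q%:R * dl <= 1 ->
  small (1 - q%:R * r) [set x | ~ exists i : 'I_q, val (x - d *+ i) < r].
Proof.
move=> r0 h.
have q1 : (1 : R) <= q%:R by rewrite ler1n.
have r1 : r <= 1.
  by have := ler_wpM2r r0 q1; have := mulr_gt0 (lt_le_trans ltr01 q1) dl_gt0; lra.
pose F (i : 'I_q) := [set x | val (x - d *+ i) < r].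
have mF i : measurable (F i) by exact: measurable_shift_set (measurable_arc r).
have tF : trivIset setT F.
  by apply/trivIsetP => i j _ _ /eqP ij; apply/seteqP; split=> // x [hi hj];
     apply: ij; exact: visit_unique hi hj.
pose D := \big[setU/set0]_(i < q) F i.
have mD : measurable D by exact: bigsetU_measurable.
have muD : mu D = (q%:R * r)%:E.
  rewrite measure_bigsetU_ord // (eq_bigr (fun=> r%:E)); last first.
    move=> i _; rewrite -(@circle_measure_arc R r) ?r0 //.
    exact: (circle_measure_shift (- (d *+ i)) (measurable_arc r)).
  by rewrite sumEFin sumr_const card_ord mulr_natl.
apply: small_sub (small_measure (measurableC mD) _).
  move=> x /= H Dx; apply: H; move: Dx; rewrite /D.
  elim/big_ind : _ => [[]|A B hA hB []|i _ Fi] //; by exists i.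
have -> : mu (~` D) = (1 - mu D)%E by exact: probability_setC.
by rewrite muD.
Qed.

(** Where a translation by less than [t] may move a point of the orbit segment
    across one of the two ends of the arc that [kap g] indicates. *)
Definition near_edge g (t : R) n x :=
  exists i : 'I_n, val (x - d *+ i) < t \/ val (x - d *+ i + g) < t.

Lemma small_near_edge g (t : R) n : 0 <= t -> small (n%:R * (t + t)) (near_edge g t n).
Proof.
move=> t0.
pose E i x := val (x - d *+ i) < t \/ val (x - d *+ i + g) < t.
have -> : n%:R * (t + t) = \sum_(i < n) (t + t) by rewrite sumr_const card_ord mulr_natl.
apply: small_sub (small_bigU (P := E) (e := fun=> t + t) _) => [x [i Hi]|i _].
  by exists i.
have h := smallU (small_shift (- (d *+ i)) (small_arc t0))
  (small_shift (- (d *+ i) + g) (small_arc t0)).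
apply: small_sub h => x [h1|h1]; [by left|right].
by rewrite -addrA in h1.
Qed.

Lemma near_edge_le g (t t' : R) n x : t' <= t -> near_edge g t' n x -> near_edge g t n x.
Proof. by move=> tt [i [h|h]]; exists i; [left|right]; exact: lt_le_trans h tt. Qed.

Lemma ksum_shift g (t : R) n x : 0 <= t < 1 -> ~ near_edge g t n x ->
  ksum g n (x - to_circle t) = ksum g n x.
Proof.
move=> t01 H; apply: eq_bigr => i _; rewrite addrAC.
by apply: kap_shift => //; rewrite leNgt; apply/negP => h; apply: H; exists i; [left|right].
Qed.

Lemma ksumD g m n x : ksum g (m + n) x = ksum g m x + ksum g n (x - d *+ m).
Proof.
rewrite /ksum big_split_ord /=; congr (_ + _); apply: eq_bigr => i _.
by rewrite mulrnDr opprD addrA.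
Qed.

Lemma ksum_telescope g n x :
  kap g (x - d *+ n) - kap g x = ksum g n (x - d) - ksum g n x.
Proof.
have h1 : ksum g n.+1 x = ksum g n x + kap g (x - d *+ n).
  by rewrite /ksum big_ord_recr.
have h2 : ksum g (1 + n) x = kap g x + ksum g n (x - d).
  by rewrite ksumD /ksum big_ord1 mulr0n subr0 mulr1n.
move: h2; rewrite add1n h1.
by move: (ksum _ _ _) (ksum _ _ _) (kap _ _) (kap _ _) => a1 a2 a3 a4; clear; lia.
Qed.

Let dq : d *+ q = to_circle dl.
Proof. by rewrite -to_circleMn thE addrC to_circleDz. Qed.

(** Away from the end points, the [b] consecutive blocks of length [q] are
    translates of each other by multiples of [dl] and count the same. *)
Lemma ksum_block g b x : b%:R * dl < 1 -> ~ near_edge g (b%:R * dl) q x ->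
  ksum g (b * q) x = b%:Z * ksum g q x.
Proof.
move=> b1 H.
suff : forall l, (l <= b)%N -> ksum g (l * q) x = l%:Z * ksum g q x by exact.
elim=> [|l IH] lb; first by rewrite mul0n /ksum big_ord0 mul0r.
have ll : l%:R * dl <= b%:R * dl by rewrite ler_pM2r // ler_nat ltnW.
rewrite mulSnr ksumD IH 1?ltnW // mulnC mulrnA dq -to_circleMn ksum_shift.
- by rewrite -[in RHS]addn1 PoszD mulrDl mul1r.
- by rewrite mulr_ge0 ?(ltW dl_gt0) //= (le_lt_trans ll).
- by move=> /(near_edge_le ll).
Qed.

Lemma ksum_visits g x : ksum g q x = visits (val g) (x + g).
Proof. by apply: eq_bigr => i _; rewrite /kap addrAC. Qed.

Lemma ksum_discrepancy g x : q%:R * dl <= 1 ->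
  `|(ksum g q x)%:~R - q%:R * val g| <= 2.
Proof.
move=> h; rewrite ksum_visits; apply: visits_discrepancy => //.
by have /andP[-> /ltW] := val_itv g.
Qed.

(** Translating by [r] changes the orbit sum by the visits to [0, r) from [x] minus
    those from [x + g]: one and none. *)
Lemma ksum_jump g (r : R) b x : q%:R * r + q%:R * dl < 1 / 4 -> 0 <= r ->
  1 / 4 <= val (g *+ q) <= 3 / 4 -> b%:R * dl < 1 ->
  ~ near_edge g (b%:R * dl) q x -> ~ near_edge g (b%:R * dl) q (x - to_circle r) ->
  (exists i : 'I_q, val (x - d *+ i) < r) ->
  ksum g (b * q) (x - to_circle r) - ksum g (b * q) x = b%:Z.
Proof.
move=> h r0 hg b1 H H' [i hi].
have q1 : (1 : R) <= q%:R by rewrite ler1n.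
have r1 : 0 <= r < 1.
  rewrite r0 /=; have := ler_wpM2r r0 q1.
  by have := mulr_gt0 (lt_le_trans ltr01 q1) dl_gt0; lra.
rewrite !ksum_block // -mulrBr; suff -> : ksum g q (x - to_circle r) - ksum g q x = 1.
  by rewrite mulr1.
have -> : ksum g q (x - to_circle r) - ksum g q x = visits r x - visits r (x + g).
  rewrite /ksum /visits -!sumrB; apply: eq_bigr => j _.
  by rewrite -[r in RHS](val_to_circle r1) [x + g - _]addrAC arc_kap addrAC.
rewrite (visits_eq1 _ hi); last by lra.
rewrite /visits big1 ?subr0 // => j _; rewrite /arc ltNge.
by rewrite (visits_separated j h hg hi).
Qed.

End Tower.
End Stage.

(** * Skew products over the rotation *)
Section SkewProducts.
Variable R : realType.
Local Notation circle := (circle R).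
Local Notation mu := (@circle_measure R).
Implicit Types (x c : circle).

Lemma measurable_ysection_set dG (G : measurableType dG) (A : set (circle * G)) y :
  measurable A -> measurable [set x | A (x, y)].
Proof.
move=> mA; have := measurable_ysection y mA; congr measurable.
by apply/seteqP; split => x; rewrite /ysection /= inE.
Qed.

(** A section that contains [y] has mass at least [e], so the product measure of
    [A] is at least [e] times the measure of its slice at height [y]. *)
Lemma product_null_section dG (G : measurableType dG) (m2 : set G -> \bar R)
    (A : set (circle * G)) (y : G) (e : R) :
  0 < e -> (forall B, 0 <= m2 B)%E -> (forall B, B y -> (e%:E <= m2 B)%E) ->
  measurable A -> (mu \x m2)%E A = 0%E -> small 0 [set x | A (x, y)].
Proof.
move=> e0 m0 atom mA A0.
have mAy := measurable_ysection_set y mA.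
apply: small_measure => //.
have : (\int[mu]_x (e%:E * (\1_[set x | A (x, y)] x)%:E) <= (mu \x m2) A)%E.
  rewrite /product_measure1 !ge0_integralTE //; last 2 first.
    by move=> x; exact: m0.
    by move=> x; rewrite mule_ge0 // lee_fin // ltW.
  apply: ereal_sup_le => _ [h /= hle <-]; exists h => //= x.
  apply: le_trans (hle x) _; rewrite indicE; case: (boolP (x \in _)) => xA.
    by rewrite mule1; apply: atom; rewrite /xsection /= inE; rewrite inE in xA.
  by rewrite mule0.
rewrite A0 ge0_integralZl //; last 2 first.
  by apply: measurableT_comp => //; exact: measurable_indic.
  by rewrite lee_fin ltW.
by rewrite integral_indic // setIT pmule_rle0 // lte_fin.
Qed.

(** An almost everywhere invariant set agrees, outside the forward orbit of the
    exceptional set, with the strictly invariant set of the points that are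
    eventually in it. *)
Lemma ergodic_null_or_full dG (G : measurableType dG) (m2 : set G -> \bar R)
    (S : circle * G -> circle * G) (c : circle) (A : set (circle * G)) :
  (forall B, 0 <= m2 B)%E -> (forall z, (S z).1 = z.1 + c) ->
  ergodic (mu \x m2)%E S -> measurable A ->
  small 0 [set x | ~ forall y, A (x, y) <-> A (S (x, y))] ->
  let atom y := exists2 e : R, 0 < e & forall B, B y -> (e%:E <= m2 B)%E in
  (forall y, atom y -> small 0 [set x | A (x, y)]) \/
  (forall y, atom y -> small 0 [set x | ~ A (x, y)]).
Proof.
move=> m0 Sc [[mS _] erg] mA bad atom.
pose A' := \bigcup_N \bigcap_(n in [set n | (N <= n)%N]) [set z | A (iter n S z)].
have miter n : measurable [set z | A (iter n S z)].
  elim: n A mA {bad A'} => [|n IH] A mA //=.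
  have := IH _ (mS measurableT _ mA); rewrite setTI; congr measurable.
have mA' : measurable A'.
  apply: bigcup_measurable => N _; apply: bigcap_measurable => //.
  by exists N => /=.
have SA' : S @^-1` A' = A'.
  apply/seteqP; split => z [N _ H].
    exists N.+1 => // -[//|n] /= Nn; rewrite -iterS iterSr; exact: H.
  by exists N => // n /= Nn; rewrite /= -iterSr; apply: H => /=; exact: leqW.
pose B x := exists n, ~ forall y, A (x + c *+ n, y) <-> A (S (x + c *+ n, y)).
have nullB : small 0 B.
  apply: small_sub (null_cup (P := fun n => [set x | ~ forall y,
    A (x + c *+ n, y) <-> A (S (x + c *+ n, y))]) _).
    by move=> x [n Hn]; exists n.
  by move=> n; exact: (small_shift (c *+ n) bad).
have iter1 n z : (iter n S z).1 = z.1 + c *+ n.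
  by elim: n => [|n IH] /=; [rewrite addr0|rewrite Sc IH mulrSr addrA].
have AA' x y : ~ B x -> (A (x, y) <-> A' (x, y)).
  move=> Bx.
  have An n : A (iter n S (x, y)) <-> A (x, y).
    elim: n => [//|n IH]; rewrite -IH.
    have := contrapT (fun H => Bx (ex_intro _ n H)) (iter n S (x, y)).2.
    have <- : iter n S (x, y) = (x + c *+ n, (iter n S (x, y)).2).
      by rewrite [LHS]surjective_pairing iter1.
    by rewrite /=; tauto.
  split=> [H|[N _ H]]; first by exists 0%N => // n _ /=; apply/An.
  by apply/(An N); apply: H => /=.
have [h|h] := erg _ mA' SA'; [left|right] => y [e e0 atomy].
  have h0 := product_null_section e0 m0 atomy mA' h.
  rewrite -(addr0 0); apply: small_sub (smallU nullB h0) => x /= Axy.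
  by case: (pselect (B x)) => Bx; [left|right; apply/AA'].
have h0 := product_null_section e0 m0 atomy (measurableC mA') h.
rewrite -(addr0 0); apply: small_sub (smallU nullB h0) => x /= Axy.
by case: (pselect (B x)) => Bx; [left|right => H; apply: Axy; apply/AA'].
Qed.

Lemma counting_ge1 (T : choiceType) (B : set T) (y : T) :
  B y -> (1 <= counting B :> \bar R)%E.
Proof.
move=> By; rewrite /counting; case: asboolP => [fB|_]; last by rewrite leey.
rewrite lee_fin ler1n.
have : y \in finmap.enum_fset (fset_set B).
  by have : y \in fset_set B by rewrite in_fset_set // inE.
by case: (finmap.enum_fset _).
Qed.

Lemma counting_ord n (B : set 'I_n.+1) :
  counting B = (\sum_(y < n.+1) (\1_B y : R))%:E.
Proof.
rewrite /counting; case: asboolP => [fB|]; last first.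
  by case; exact: finite_finset.
congr EFin; rewrite -sum1_size natr_sum big_uniq ?finmap.fset_uniq //= big_mkcond /=.
apply: eq_bigr => y _; rewrite indicE.
have -> : (y \in finmap.enum_fset (fset_set B)) = (y \in B) by rewrite -in_fset_set.
by case: (y \in B).
Qed.

Section Finite.
Variable a : int.
Hypothesis a0 : a != 0.
Local Notation Z := (Zmod a).
Let n := `|a|%N.
Let n_gt0 : (0 < n)%N. Proof. by rewrite absz_gt0. Qed.

Lemma uniform_Zmod_atom (y : Z) :
  exists2 e : R, 0 < e & forall B, B y -> (e%:E <= uniform_Zmod R a B)%E.
Proof.
exists (n%:R^-1); first by rewrite invr_gt0 ltr0n.
move=> B By; rewrite /uniform_Zmod /mscale /= -[X in (X <= _)%E]mule1.
by rewrite lee_pmul2l ?lte_fin ?invr_gt0 ?ltr0n //; exact: counting_ge1 By.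
Qed.

Lemma product_uniformE (A : set (circle * Z)) : measurable A ->
  (mu \x uniform_Zmod R a)%E A =
  (\sum_(y < n.-1.+1) (n%:R^-1)%:E * mu [set x | A (x, y)])%E.
Proof.
move=> mA; rewrite /product_measure1.
transitivity (\int[mu]_x (\sum_(y < n.-1.+1)
    (n%:R^-1)%:E * (\1_[set x | A (x, y)] x)%:E))%E.
  apply: eq_integral => x _ /=; rewrite /uniform_Zmod /mscale /= counting_ord.
  rewrite -EFinM mulr_sumr -sumEFin; apply: eq_bigr => y _; rewrite -EFinM.
  congr (_ * _)%:E; rewrite !indicE; congr (_ %:R); congr nat_of_bool.
  by apply/idP/idP; rewrite /xsection !inE /= ?inE.
have m1 (y : Z) : measurable_fun setT (fun x : circle => (\1_[set x | A (x, y)] x : R)%:E).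
  by apply: measurableT_comp => //; apply: measurable_indic; exact: measurable_ysection_set.
rewrite ge0_integral_sum //; last by move=> y; exact: measurable_funeM.
apply: eq_bigr => y _; rewrite ge0_integralZl //.
by rewrite integral_indic ?setIT //; exact: measurable_ysection_set.
Qed.

Lemma val_residue (m : int) : (val (residue a m) : nat)%:Z = (m %% a)%Z.
Proof.
have h : (`|(m %% a)%Z| < n)%N.
  by rewrite -ltz_nat gez0_abs ?modz_ge0 // /n abszE ltz_mod.
by rewrite /residue /= modn_small ?gez0_abs ?modz_ge0 // prednK.
Qed.

Lemma residueD (m m' : int) : residue a (m + m') = residue a m + residue a m'.
Proof.
apply/val_inj/eqP; rewrite -eqz_nat; apply/eqP.
transitivity ((val (residue a m) + val (residue a m')) %% n.-1.+1)%N%:Z; last by [].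
by rewrite -modz_nat PoszD !val_residue prednK // modz_abs modzDm.
Qed.

Lemma residue0 : residue a 0 = 0.
Proof. by apply: val_inj; rewrite /= mod0z mod0n. Qed.

End Finite.

Lemma measurable_discrete2 dX (X : measurableType dX) d1 (T1 : measurableType d1)
    d2 (T2 : measurableType d2) d3 (T3 : measurableType d3)
    (f : X -> T1) (g : X -> T2) (h : T1 -> T2 -> T3) :
  countable [set: T1] -> (forall t : T1, measurable [set t]) ->
  (forall t, measurable_fun setT (h t)) ->
  measurable_fun setT f -> measurable_fun setT g ->
  measurable_fun setT (fun w => h (f w) (g w)).
Proof.
move=> cT1 mT1 mh mf mg _ B mB; rewrite setTI.
have -> : (fun w => h (f w) (g w)) @^-1` B =
    \bigcup_t (f @^-1` [set t] `&` g @^-1` (h t @^-1` B)).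
  apply/seteqP; split=> [w Hw|w [t _ /= [<-]] //]; by exists (f w).
apply: countable_bigcupT_measurable => // t; apply: measurableI.
  by rewrite -[X in measurable X]setTI; exact: mf.
rewrite -[X in measurable X]setTI; apply: mg => //.
by rewrite -[X in measurable X]setTI; exact: mh.
Qed.

Lemma measurable_int_fun2 dX (X : measurableType dX) d3 (T3 : measurableType d3)
    (f g : X -> int) (h : int -> int -> T3) :
  measurable_fun setT f -> measurable_fun setT g ->
  measurable_fun setT (fun w => h (f w) (g w)).
Proof.
move=> mf mg; apply: measurable_discrete2 => //; exact: countableP.
Qed.

Lemma measurable_indic_int dX (X : measurableType dX) (A : set X) : measurable A ->
  measurable_fun setT (\1_A : X -> int).
Proof.
move=> mA _ B _; rewrite setTI.
have -> : (\1_A : X -> int) @^-1` B =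
    (A `&` [set x | B 1]) `|` (~` A `&` [set x | B 0]).
  apply/seteqP; split => x /=; rewrite indicE.
    by case: (boolP (x \in A)); rewrite ?notin_setE ?inE => h; [left|right].
  by case: (boolP (x \in A)); rewrite ?notin_setE ?inE => h [] [].
have mP (P : Prop) : measurable [set x : X | P].
  by case: (pselect P) => p; [rewrite (_ : [set _ | _] = setT)|
    rewrite (_ : [set _ | _] = set0)] => //; apply/seteqP; split.
by apply: measurableU; apply: measurableI => //; exact: measurableC.
Qed.

Lemma measurable_arc_fun (r : R) : measurable_fun setT (arc r : circle -> int).
Proof.
have -> : arc r = \1_[set x : circle | val x < r] :> (circle -> int).
  apply/funext => x; rewrite indicE /arc -natz; congr ((nat_of_bool _)%:R).
  by apply/idP/idP; rewrite inE.
by apply: measurable_indic_int; exact: measurable_arc.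
Qed.

Lemma measurable_sum_int dX (X : measurableType dX) n (f : nat -> X -> int) :
  (forall i, measurable_fun setT (f i)) ->
  measurable_fun setT (fun t => \sum_(i < n) f i t).
Proof.
move=> mf; elim: n => [|n IH].
  rewrite (_ : (fun _ => _) = cst 0); first exact: measurable_cst.
  by apply/funext => t; rewrite big_ord0.
rewrite (_ : (fun _ => _) = (fun t => (\sum_(i < n) f i t) + f n t)).
  exact: (measurable_int_fun2 (fun z t => z + t) IH (mf n)).
by apply/funext => t; rewrite big_ord_recr.
Qed.

Section FiniteErgodic.
Variables (a : int) (alpha : R) (r : circle -> Zmod a).
Hypotheses (a0 : a != 0) (irr : irrational alpha).
Hypothesis mr : measurable_fun setT r.
Local Notation Z := (Zmod a).
Let d := to_circle alpha.
Let n := `|a|%N.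
Let n_gt0 : (0 < n)%N. Proof. by rewrite absz_gt0. Qed.
Let S := skew_product (rotation alpha) r.

Let mS : measurable_fun setT S.
Proof.
have mrf : measurable_fun setT (r \o fst : circle * Z -> Z) by exact: measurableT_comp.
have mg : measurable_fun setT (fun z : circle * Z => z.2 + r z.1).
  exact: (@measurable_discrete2 _ (circle * Z)%type _ Z _ Z _ Z (r \o fst) snd
    (fun v y => y + v) (countableP _)).
apply: measurable_fun_pair mg.
exact: (measurableT_comp (measurable_shiftc d) measurable_fst).
Qed.

(** A section and its translates have the same number of points, so only the
    rotation of the slices matters. *)
Lemma skew_Zmod_preserving : measure_preserving (mu \x uniform_Zmod R a)%E S.
Proof.
split=> // A mA.
pose A2 := [set z : circle * Z | A (z.1 + d, z.2)].
have mA2 : measurable A2.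
  have : measurable_fun setT (fun z : circle * Z => (z.1 + d, z.2)).
    apply: measurable_fun_pair => //.
    exact: (measurableT_comp (measurable_shiftc d) measurable_fst).
  by move=> /(_ measurableT _ mA); rewrite setTI.
transitivity ((mu \x uniform_Zmod R a)%E A2).
  apply: eq_integral => x _ /=; rewrite /uniform_Zmod /mscale /= !counting_ord.
  congr (_ * _%:E)%E.
  rewrite [RHS](reindex_inj (addIr (r x))) /=; apply: eq_bigr => y _.
  rewrite !indicE; suff -> : (y \in xsection (S @^-1` A) x) = (y + r x \in xsection A2 x) by [].
  by apply/idP/idP; rewrite /xsection !inE /= ?inE.
rewrite !product_uniformE //; apply: eq_bigr => y _; congr (_ * _)%E.
exact: (circle_measure_shift d (measurable_ysection_set y mA)).
Qed.

(** Over an ergodic rotation, the points over which the fibre of an invariant set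
    is itself invariant under the generator 1 of Z/aZ form an invariant set; if
    it is not null, it has full measure and the set is a union of fibres. *)
Lemma skew_Zmod_ergodic :
  (forall A : set (circle * Z), measurable A ->
    (forall x y, A (x, y) <-> A (x + d, y + r x)) ->
    ~ small 0 [set x | forall y, A (x, y) <-> A (x, y + residue a 1)]) ->
  ergodic (mu \x uniform_Zmod R a)%E S.
Proof.
move=> crit; split; first exact: skew_Zmod_preserving.
move=> A mA SA.
have inv x y : A (x, y) <-> A (x + d, y + r x).
  by rewrite -{1}SA.
have allP (P : Z -> set circle) : (forall y, measurable (P y)) ->
    measurable [set x | forall y, P y x].
  move=> mP; rewrite (_ : [set _ | _] = \bigcap_y P y).
    rewrite -[X in measurable X]setCK setC_bigcap; apply: measurableC.
    by apply: countable_bigcupT_measurable => // y; exact: measurableC.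
  by apply/seteqP; split=> x H y //=; exact: H.
have mAy y : measurable [set x | A (x, y)] by exact: measurable_ysection_set.
pose N := [set x | forall y, A (x, y) <-> A (x, y + residue a 1)].
have mNy y : measurable [set x | A (x, y) <-> A (x, y + residue a 1)].
  rewrite (_ : [set _ | _] =
     ([set x | A (x, y)] `&` [set x | A (x, y + residue a 1)]) `|`
     (~` [set x | A (x, y)] `&` ~` [set x | A (x, y + residue a 1)])).
    by apply: measurableU; apply: measurableI => //; exact: measurableC.
  apply/seteqP; split=> x /=; last tauto.
  by move=> h; case: (pselect (A (x, y))) => H; tauto.
have mN : measurable N by exact: allP mNy.
have invN x : N x <-> N (x + d).
  split=> H y; last first.
    by rewrite (inv x y) (inv x (y + _)) addrAC; exact: H.
  have := H (y - r x).
  by rewrite (inv x (y - r x)) (inv x (y - r x + _)) [y - _ + _ + _]addrAC !subrK.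
have mN0 : mu N = 0%E -> False.
  by move=> N0; apply: (crit A mA inv); apply: small_measure => //; rewrite N0.
have [/mN0//|N1] := rotation_invariant_null_or_full irr mN invN.
have one m x : N x -> A (x, 0) <-> A (x, residue a 1 *+ m).
  by move=> Nx; elim: m => [|m IH]; [rewrite mulr0n|rewrite IH mulrSr; exact: Nx].
have gen (y : Z) : y = residue a 1 *+ (val y).
  have -> : residue a 1 *+ val y = residue a (val y)%:Z.
    elim: (val y) => [|m IH]; first by rewrite mulr0n residue0.
    by rewrite mulrSr IH -residueD // -PoszD addn1.
  apply/val_inj/eqP; rewrite -eqz_nat val_residue //.
  have yn : (val y < `|a|)%N by rewrite (leq_trans (ltn_ord y)) // prednK.
  by rewrite -modz_abs modz_nat modn_small.
have fibre x y : N x -> A (x, 0) <-> A (x, y) by rewrite (gen y); exact: one.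
pose X := [set x | forall y, A (x, y)].
have mX : measurable X by exact: allP.
have invX x : X x <-> X (x + d).
  split=> H y; last by rewrite inv; exact: H.
  by have := H (y - r x); rewrite (inv x (y - r x)) subrK.
have nN : small 0 (~` N) by apply: small_measure; [exact: measurableC|rewrite N1].
have [X0|X1] := rotation_invariant_null_or_full irr mX invX; [left|right].
  rewrite product_uniformE // big1 // => y _.
  have -> : mu [set x | A (x, y)] = 0%E; last by rewrite mule0.
  apply/eqP; rewrite eq_le measure_ge0 andbT; apply: measure_small => //.
  have sX : small 0 X by apply: small_measure => //; rewrite X0.
  rewrite -(addr0 0); apply: small_sub (smallU nN sX) => x /= Axy.
  case: (pselect (N x)) => Nx; last by left.
  by right => z; rewrite -fibre // (fibre x y).
rewrite product_uniformE //; last exact: measurableC.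
rewrite big1 // => y _; have -> : mu [set x | (~` A) (x, y)] = 0%E; last by rewrite mule0.
have mCy : measurable [set x | (~` A) (x, y)].
  exact: (measurableC (mAy y)).
apply/eqP; rewrite eq_le measure_ge0 andbT; apply: measure_small => //.
have sX : small 0 (~` X) by apply: small_measure; [exact: measurableC|rewrite X1].
by apply: small_sub sX => x /= H HX; apply: H; exact: HX.
Qed.

End FiniteErgodic.
End SkewProducts.

(** * The step cocycle *)
Section Construction.
Variable R : realType.
Local Notation circle := (circle R).
Local Notation mu := (@circle_measure R).
Implicit Types (x : circle) (n j k : nat).
Local Notation w := (decay R).
Let w_gt0 k : 0 < w k := decay_gt0 R k.
Let wS k : w k = 2 * w k.+1 := decayS R k.
Let w_le1 k : w k <= 1 := decay_le1 R k.

Lemma arcD (s t : R) x : 0 <= s -> 0 <= t -> s + t < 1 ->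
  arc (s + t) x - arc s x = arc t (x - to_circle s).
Proof.
move=> s0 t0 st; apply: (mulrIz (oner_neq0 R)).
have sv : val (to_circle s) = s by apply: val_to_circle; apply/andP; split; lra.
have tv : val (to_circle t) = t by apply: val_to_circle; apply/andP; split; lra.
have stv : val (to_circle (s + t)) = s + t by apply: val_to_circle; apply/andP; split; lra.
rewrite intrB; have := arcE (to_circle (s + t)) x; rewrite stv => ->.
have := arcE (to_circle s) x; rewrite sv => ->.
have := arcE (to_circle t) (x - to_circle s); rewrite tv => ->.
have -> : x - to_circle (s + t) = x - to_circle s - to_circle t.
  by rewrite to_circleD opprD addrA.
lra.
Qed.

(** The transfer function of stage [j] sums over [b j * q j] points and is observed
    at time [c j * q j]; stage [k] has to be sparse with respect to both, for all
    [j < k]. *)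
Definition weight (b c q : nat -> nat) k : nat := (\sum_(j < k) (b j * q j + c j * q j))%N.

(** Stage [k] uses the convergent of index [n k], with denominator [q k]: its signed
    error is [dl k], the sign being [s k], and the step grows by [b k * dl k].

    [stage_mult_mod] makes the jumps [b k] visible in every finite quotient, while
    [stage_mult_near] hides them modulo 1 once multiplied by [alpha]. [stage_quot]
    gives membership in H_1. [stage_short] makes the blocks of length [q k] nearly
    equal, [stage_sparse] keeps the stages from interfering, and [stage_height]
    gives the tower of stage [k] a measure bounded below, while its levels stay
    far apart. *)
Record stages (alpha : R) (s : nat -> bool) (n q b c : nat -> nat)
    (p u v : nat -> int) (dl : nat -> R) : Prop := Stages {
  stage_index : forall k, (k < n k)%N;
  stage_den : forall k, q k = cf_den alpha (n k);
  stage_den_gt0 : forall k, (0 < q k)%N;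
  stage_gap : forall k, (q k)%:R * ((-1) ^+ s k * alpha) = (p k)%:~R + dl k;
  stage_gap_gt0 : forall k, 0 < dl k;
  stage_bezout : forall k, u k * p k + v k * (q k)%:Z = 1;
  stage_mult_gt0 : forall k, (0 < b k)%N;
  stage_mult_mod : forall k m, (0 < m <= k)%N -> b k = 1 %[mod m];
  stage_mult_near : forall k, exists P : int, `|(b k)%:R * alpha - P%:~R| <= w k;
  stage_quot : forall k, (b k)%:R / (cf_quot alpha (n k).+1)%:R <= w k / 32;
  stage_short : forall k, (q k)%:R * ((b k)%:R * dl k) <= w k / 32;
  stage_sparse : forall k, (weight b c q k)%:R <= w k / 32 * (q k)%:R;
  stage_height : forall k, 1 / 32 <= (q k)%:R * ((c k)%:R * dl k) <= 1 / 16 }.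

Section Data.
Variables (alpha : R) (s : nat -> bool) (n_ q b c : nat -> nat).
Variables (p u v : nat -> int) (dl : nat -> R).
Hypothesis St : stages alpha s n_ q b c p u v dl.
Let th k : R := (-1) ^+ s k * alpha.

Let q_gt0 := stage_den_gt0 St.
Let dl_gt0 := stage_gap_gt0 St.
Let thE k : (q k)%:R * th k = (p k)%:~R + dl k := stage_gap St k.
Let bezout := stage_bezout St.
Let b_gt0 := stage_mult_gt0 St.
Let short := stage_short St.
Let sparse := stage_sparse St.
Let height := stage_height St.

Let W k := weight b c q k.
Let d := to_circle alpha.
Let d' k := to_circle (th k).

Let q_ge1 k : 1 <= (q k)%:R :> R. Proof. by rewrite ler1n. Qed.

Let d'E k : d' k = if s k then - d else d.
Proof.
by rewrite /d' /th; case: (s k); rewrite ?expr1 ?expr0 ?mulN1r ?mul1r ?to_circleN.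
Qed.

Let d'q k : d' k *+ q k = to_circle (dl k).
Proof. by rewrite /d' -to_circleMn thE addrC to_circleDz. Qed.

Let eps k := (b k)%:R * dl k.
Let eps_gt0 k : 0 < eps k.
Proof. by rewrite mulr_gt0 // ltr0n. Qed.

Let eps_le k : eps k <= w k / 32.
Proof.
by apply: le_trans (short k); apply: ler_peMl; [exact: ltW|].
Qed.

Let dl_le k : (q k)%:R * dl k <= w k / 32.
Proof.
apply: le_trans (short k); rewrite ler_wpM2l //; apply: ler_peMl; first exact: ltW.
by rewrite ler1n.
Qed.

(** The right ends of the successive approximations of [0, beta]. *)
Definition cut_points n : R := \sum_(k < n) ((b k)%:R * dl k).
Let B := cut_points.
Definition step_length : R := sup (range cut_points).
Let beta := step_length.

Let BS n : B n.+1 = B n + eps n. Proof. by rewrite /B /cut_points big_ord_recr. Qed.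

Let B_ge0 n : 0 <= B n.
Proof. by apply: sumr_ge0 => k _; exact: ltW (eps_gt0 k). Qed.

Let B_incr m n : B (m + n) - B m <= (w m - w (m + n)) / 16.
Proof.
elim: n => [|n IH]; first by rewrite addn0 !subrr mul0r.
by rewrite addnS BS; have := eps_le (m + n); have := wS (m + n); lra.
Qed.

Let B_mono m n : B m <= B (m + n).
Proof.
by elim: n => [|n IH]; rewrite ?addn0 // addnS BS; have := eps_gt0 (m + n); lra.
Qed.

Let B_bound n : B n <= 1 / 16.
Proof.
have := B_incr 0 n; rewrite add0n /B {2}/cut_points big_ord0 /w expr0.
have := w_gt0 n; rewrite /w; lra.
Qed.

Let B_sup : has_sup (range B).
Proof.
by split; [exists (B 0%N), 0%N|exists (1 / 16) => _ [n _ <-]; exact: B_bound].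
Qed.

Lemma cut_points_le n : cut_points n <= step_length.
Proof. by apply: sup_upper_bound => //; exists n. Qed.

Let B_le_beta n : B n <= beta. Proof. exact: cut_points_le. Qed.

Let beta_le (y : R) m : (forall n, B (m + n) <= y) -> beta <= y.
Proof.
move=> h; apply: ge_sup; first by case: B_sup.
by move=> _ [n _ <-]; apply: le_trans (h n); rewrite addnC; exact: B_mono.
Qed.

Let beta_itv : 0 <= beta < 1.
Proof.
apply/andP; split; first exact: le_trans (B_ge0 0) (cut_points_le 0).
apply: (@le_lt_trans _ _ (1 / 16)); last by lra.
by apply: (@beta_le _ 0) => n; exact: B_bound.
Qed.

Lemma cut_points_cvg n : `|cut_points n - step_length| <= w n / 16.
Proof.
rewrite ler0_norm ?subr_le0 ?cut_points_le // opprB lerBlDl.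
by apply: (@beta_le _ n) => m; have := B_incr n m; have := w_gt0 (n + m); rewrite /B; lra.
Qed.

Let le_weight j k : (k < j)%N -> (c k * q k <= W j)%N.
Proof.
by move=> kj; rewrite /W /weight (bigD1 (Ordinal kj)) //=; lia.
Qed.

(** Beyond stage [k] the step function only changes on a set that an orbit of
    length [c k * q k] rarely meets. *)
Let tail_bound k : (c k * q k)%:R * (beta - B k.+1) <= w k / 32.
Proof.
set m := (c k * q k)%N.
have step n : m%:R * (B (k.+1 + n) - B k.+1) <= (w k - 2 * w (k.+1 + n)) / 32.
  elim: n => [|n IH]; first by rewrite addn0 subrr mulr0 wS subrr mul0r.
  rewrite addnS BS; set j := (k.+1 + n)%N in IH *.
  have mj : m%:R * eps j <= w j / 32.
    have h1 : (m%:R : R) <= w j / 32 * (q j)%:R.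
      by apply: le_trans (sparse j); rewrite ler_nat le_weight // /j addSn ltnS leq_addr.
    apply: le_trans (ler_wpM2r (ltW (eps_gt0 j)) h1) _.
    have X1 : (q j)%:R * eps j <= 1.
      by have := short j; have := w_le1 j; rewrite /eps; lra.
    have w0 : 0 <= w j / 32 by rewrite divr_ge0 // ltW.
    by have := ler_wpM2l w0 X1; rewrite /eps; lra.
  by have := wS j; rewrite -/(w j.+1); lra.
have [m0|m0] := posnP m; first by rewrite m0 mul0r divr_ge0 // ltW.
have m0' : (0 : R) < m%:R by rewrite ltr0n.
rewrite -ler_pdivlMl // lerBlDl; apply: (@beta_le _ k.+1) => n.
rewrite -lerBlDl ler_pdivlMl //; apply: le_trans (step n) _.
by have := w_gt0 (k.+1 + n); lra.
Qed.

Section Transfer.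
Variable gamma : R.
Let g := to_circle gamma.
Let phi := step_cocycle (to_circle beta) gamma.

Let vv k := to_circle (B k) + (if s k then 0 else d).
Let K k x := ksum (th k) g (b k * q k) x.

(** Summing the indicator of a translate of [0, gamma) along the orbit segment
    that carries the stage [k] piece gives a transfer function for it. *)
Definition transfer k x : int := (-1) ^+ (~~ s k) * K k (x - vv k).

Let transfer_step k x :
  arc (eps k) (x - to_circle (B k)) - arc (eps k) (x - to_circle (B k) + g) =
  transfer k (x + d) - transfer k x.
Proof.
have e01 : 0 <= eps k < 1.
  by rewrite ltW //=; have := eps_le k; have := w_le1 k; lra.
have eE : to_circle (eps k) = d' k *+ (b k * q k).
  by rewrite mulnC mulrnA d'q -to_circleMn.
rewrite -[X in arc X](val_to_circle e01) arc_kap eE (ksum_telescope (th k)).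
rewrite /transfer /K /vv -/(d' k) d'E; case: (s k) => /=.
  by rewrite expr0 !mul1r addr0 opprK addrAC.
rewrite expr1 !mulN1r opprK [RHS]addrC !opprD addrACA subrr addr0.
by rewrite [x + (_ - d)]addrA.
Qed.

Definition transfer_sum n x : int := \sum_(k < n) transfer k x.
Let G := transfer_sum.

Let G_step n x : arc (B n) x - arc (B n) (x + g) = G n (x + d) - G n x.
Proof.
elim: n => [|n IH].
  have z y : arc (B 0%N) y = 0.
    rewrite /arc /B /cut_points big_ord0 ltNge.
    by have /andP[-> _] := val_itv y.
  by rewrite !z /G /transfer_sum !big_ord0.
have st y : arc (B n.+1) y = arc (B n) y + arc (eps n) (y - to_circle (B n)).
  rewrite -arcD ?(ltW (eps_gt0 n)) // -?BS; first by rewrite addrC subrK.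
  by have := B_bound n.+1; lra.
rewrite !st [x + g - _]addrAC /G /transfer_sum !big_ord_recr /=.
have := transfer_step n x; rewrite /G /transfer_sum in IH.
by move=> e; rewrite opprD addrACA IH e opprD addrACA.
Qed.

Definition tail n x := B n <= val x <= beta.

Let small_tail n : small (beta - B n) (tail n).
Proof.
have t0 : 0 <= beta - B n by rewrite subr_ge0 cut_points_le.
pose t := beta - B n.
have h1 := small_shift (- to_circle (B n)) (small_arc t0).
have h2 := null_point (to_circle beta).
rewrite -[beta - B n]addr0; apply: small_sub (smallU h1 h2) => x /andP[x1 x2].
have [xb|xb] := eqVneq (val x) beta; first by right; rewrite /= -xb to_circleK.
left; change (val (x - to_circle (B n)) < beta - B n).
have -> : x - to_circle (B n) = to_circle (val x - B n).
  by rewrite to_circleB to_circleK.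
have /andP[_ b1] := beta_itv; have Bn := B_ge0 n.
have xb' : val x < beta by rewrite lt_neqAle xb.
by rewrite val_to_circle; [lra|apply/andP; split; lra].
Qed.

Lemma step_cocycle_transfer n x : ~ tail n x -> ~ tail n (x + g) ->
  phi x = transfer_sum n (x + d) - transfer_sum n x.
Proof.
have ind y : ~ tail n y ->
    \1_[set y : circle | val y <= val (to_circle beta)] y = arc (B n) y :> int.
  move=> /negP; rewrite /tail negb_and -!ltNge => h.
  rewrite indicE /arc -natz; congr ((nat_of_bool _)%:R).
  rewrite val_to_circle //; apply/idP/idP; rewrite inE /=.
    by move=> yb; case/orP: h => //; rewrite ltNge yb.
  by move=> yb; rewrite (le_trans (ltW yb)).
by move=> h h'; rewrite -G_step /phi /step_cocycle /= !ind.
Qed.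

Lemma step_cocycle_sum m n x :
  (forall t, (t < m)%N -> ~ tail n (x + d *+ t) /\ ~ tail n (x + d *+ t + g)) ->
  \sum_(t < m) phi (x + d *+ t) = transfer_sum n (x + d *+ m) - transfer_sum n x.
Proof.
elim: m => [|m IH] h; first by rewrite big_ord0 addr0 subrr.
rewrite big_ord_recr /= IH; last by move=> t tm; apply: h; exact: ltnW.
have [h1 h2] := h m (ltnSn m).
have -> : x + d *+ m.+1 = x + d *+ m + d by rewrite mulrSr addrA.
by rewrite (step_cocycle_transfer h1 h2); lia.
Qed.

(** At time [c k * q k] the stages before [k] have not moved, those after [k] have
    not been met, and stage [k] contributes exactly [b k] on the tower. *)
Lemma small_no_jump k : 1 / 4 <= val (g *+ q k) <= 3 / 4 ->
  small (31 / 32 + w k)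
    [set x | \sum_(t < c k * q k) phi (x + d *+ t) <> (b k)%:Z].
Proof.
move=> sep; set m := (c k * q k)%N; pose r := (c k)%:R * dl k; pose e := to_circle r.
have r0 : 0 <= r by rewrite mulr_ge0 // ltW.
have /andP[hl hu] := height k; rewrite -/r in hl hu.
have dm : d' k *+ m = e.
  by rewrite /m mulnC mulrnA d'q /e /r to_circleMn.
pose zz := if s k then 0 else e.
have jump (f : circle -> int) x :
    f (x + d *+ m) - f x = (-1) ^+ (~~ s k) * (f (x + zz - e) - f (x + zz)).
  move: dm; rewrite d'E /zz; case: (s k) => /= <-.
    by rewrite expr0 mul1r mulNrn opprK addr0.
  by rewrite expr1 mulN1r addrK opprB.
have wk := w_gt0 k; have wk1 := w_le1 k.
have ql := dl_le k; have qs := short k.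
have q1 := q_ge1 k.
have r1 : r < 1 by have := ler_wpM2r r0 q1; lra.
have e1 : eps k < 1 by have := eps_le k; lra.
have U1 := small_shift (zz - vv k) (small_unvisited (q_gt0 k) (dl_gt0 k) (thE k) (bezout k) r0
  (ltac:(lra) : (q k)%:R * r + (q k)%:R * dl k <= 1)).
have U23 := small_near_edge (th k) g (q k) (ltW (eps_gt0 k)).
have U2 := small_shift (zz - vv k) U23.
have U3 := small_shift (zz - vv k - e) U23.
have U4 := small_bigU (n := k) (e := fun j => (b j * q j)%:R * (r + r))
  (P := fun j => [set x | near_edge (th j) g r (b j * q j) (x + (zz - vv j))])
  (fun j _ => small_shift _ (small_near_edge (th j) g (b j * q j) r0)).
have U5 := small_bigU (n := m) (e := fun=> (beta - B k.+1) + (beta - B k.+1))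
  (P := fun t => [set x | tail k.+1 (x + d *+ t)] `|` [set x | tail k.+1 (x + (d *+ t + g))])
  (fun t _ => smallU (small_shift _ (small_tail k.+1)) (small_shift _ (small_tail k.+1))).
have U := smallU U1 (smallU U2 (smallU U3 (smallU U4 U5))).
refine (small_sub _ (small_le _ U)); last first.
  rewrite -mulr_suml sumr_const card_ord -[_ *+ m]mulr_natl -natr_sum.
  have tb := tail_bound k; rewrite -/m in tb.
  have h4 : (\sum_(i < k) b i * q i)%:R * r <= w k / 32 * (1 / 16).
    apply: (@le_trans _ _ (w k / 32 * ((q k)%:R * r))); last first.
      by rewrite ler_wpM2l // divr_ge0 // ltW.
    rewrite mulrA ler_wpM2r //; apply: le_trans (sparse k).
    by rewrite ler_nat /W /weight; apply: leq_sum => j _; exact: leq_addr.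
  move: hl qs h4 tb; rewrite -/(eps k); set X1 := _ * r; set X2 := _ * eps k.
  rewrite !mulrDr -/X2; lra.
move=> x /= H; apply: contrapT => /not_orP[/contrapT H1].
move=> /not_orP[H2 /not_orP[H3 /not_orP[H4 H5]]]; apply: H.
rewrite (step_cocycle_sum (n := k.+1)); last first.
  move=> t tm; split=> ht; apply: H5; exists t => //; first by left.
  by right; rewrite /= addrA.
rewrite /transfer_sum -sumrB big_ord_recr /= big1 ?add0r; last first.
  move=> j _; rewrite jump /transfer.
  rewrite /K [x + zz - e - _]addrAC -[x + zz - vv j]addrA ksum_shift ?subrr ?mulr0 ?r0 //.
  by move=> h; apply: H4; exists j.
rewrite jump /transfer -mulrBr mulrA -expr2 sqrr_sign mul1r.
rewrite [x + zz - e - _]addrAC -[x + zz - vv k]addrA /K.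
apply: (ksum_jump (q_gt0 k) (dl_gt0 k) (thE k) (bezout k)) => //; first by lra.
by move=> h; apply: H3; rewrite /= [x + _]addrA.
Qed.

Hypothesis irr : irrational alpha.
Let b_mod := stage_mult_mod St.

Let height_le k : (0 < k)%N -> (c k)%:R * dl k <= w k.
Proof.
move=> k0; have /andP[_ hu] := height k.
have W1 : (1 : R) <= (W k)%:R.
  rewrite ler1n /W /weight (bigD1 (Ordinal k0)) //= -addnA addn_gt0.
  by rewrite muln_gt0 b_gt0 q_gt0.
have := le_trans W1 (sparse k) => h.
have r0 : 0 <= (c k)%:R * dl k by rewrite mulr_ge0 // ltW.
have := ler_wpM2r r0 h; rewrite mul1r => h1.
have w0 := w_gt0 k; have w1 : 0 <= w k / 32 by rewrite divr_ge0 // ltW.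
by have := ler_wpM2l w1 hu; lra.
Qed.

Lemma measurable_step_cocycle : measurable_fun setT phi.
Proof.
pose I := [set y : circle | val y <= val (to_circle beta)].
have mI : measurable I.
  have := measurable_circle_val measurableT (measurable_itv `]-oo, (val (to_circle beta))]).
  by rewrite setTI; congr measurable; apply/seteqP; split => x /=; rewrite in_itv.
have m1 : measurable_fun setT (\1_I : circle -> int) by exact: measurable_indic_int.
have m2 : measurable_fun setT ((\1_I : circle -> int) \o (fun x => x + g)).
  by apply: measurableT_comp m1 _; exact: measurable_shiftc.
exact: (measurable_int_fun2 (fun z t => z - t) m1 m2).
Qed.

Hypothesis separated : forall N, exists2 k, (N <= k)%N & 1 / 4 <= val (g *+ q k) <= 3 / 4.

(** At the times [c k * q k] the rotation is close to the identity, so an invariant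
    set has nearly the same fibre over a point and over its image; but the fibre is
    translated by [b k], which is 1 modulo [a], for a proportion of the points that
    is bounded below. *)
Lemma quotient_ergodic (a : int) : a != 0 ->
  ergodic (mu \x uniform_Zmod R a)%E
    (skew_product (rotation alpha) (fun x => residue a (phi x))).
Proof.
move=> a0; apply: (skew_Zmod_ergodic a0 irr).
  by apply: (measurableT_comp _ measurable_step_cocycle).
move=> A mA inv N0.
(* Otherwise some point lies on the tower, has a fibre that is not invariant and
   has the same fibre as its image. *)
have iterA m x y : A (x, y) <-> A (x + d *+ m, y + residue a (\sum_(t < m) phi (x + d *+ t))).
  elim: m => [|m IH]; first by rewrite big_ord0 residue0 !addr0.
  apply: (iff_trans IH); apply: (iff_trans (inv _ _)).
  have -> : x + d *+ m.+1 = x + d *+ m + d by rewrite mulrSr addrA.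
  by rewrite big_ord_recr /= (residueD a0 _ (phi (x + d *+ m))) addrA.
pose P i := [set x : circle | A (x, inord i)].
have mP i : measurable (P i) by exact: measurable_ysection_set.
have e0 : (0 : R) < 1 / 128 by lra.
have [h h0 hP] := shift_continuous_family `|a|%N.-1.+1 mP e0.
have [K1 hK1] := decay_small h0; have [K2 hK2] := decay_small e0.
have [k] := separated (K1 + K2 + `|a|%N).+1.
move=> kK sep; pose m := (c k * q k)%N; pose e := to_circle ((c k)%:R * dl k).
have k0 : (0 < k)%N by exact: leq_trans kK.
have wk1 : w k < h by apply: hK1; apply: leq_trans (ltnW kK); rewrite -addnA leq_addr.
have wk2 : w k < 1 / 128.
  by apply: hK2; apply: leq_trans (ltnW kK); rewrite addnAC leq_addl.
have ak : (`|a| <= k)%N by apply: leq_trans (ltnW kK); exact: leq_addl.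
have r0 : 0 <= (c k)%:R * dl k by rewrite mulr_ge0 // ltW.
have rw := height_le k0.
have ev : val e = (c k)%:R * dl k by apply: val_to_circle; apply/andP; split; lra.
have hPe := hP e (ltac:(rewrite ev; lra)).
have dm : d *+ m = if s k then - e else e.
  have : d' k *+ m = e by rewrite /m mulnC mulrnA d'q /e to_circleMn.
  by rewrite d'E; case: (s k) => // <-; rewrite mulNrn opprK.
have hPm : small (1 / 128)
    [set x | exists2 i, (i < `|a|.-1.+1)%N & ~ (P i x <-> P i (x + d *+ m))].
  rewrite dm; case: (s k) => //.
  apply: small_sub (small_shift (- e) hPe) => x [i ia H]; exists i => //= H'.
  by apply: H; rewrite H' subrK.
have := smallU (small_no_jump sep) (smallU hPm N0).
move/small_exists => /(_ (ltac:(lra))) [x].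
move=> /not_orP[/contrapT jump /not_orP[H2 H3]]; apply: H3 => y.
rewrite (iterA m x y) jump.
have -> : residue a (b k)%:Z = residue a 1.
  apply: val_inj => /=; congr (_ %% _)%N; congr absz.
  by rewrite -!(modz_abs _ a) !modz_nat b_mod // absz_gt0 a0.
have := contrapT (fun h => H2 (ex_intro2 _ _ (val (y + residue a 1)) (ltn_ord _) h)).
by rewrite /P /mkset inord_val => ->.
Qed.
Let measurable_transfer k : measurable_fun setT (transfer k).
Proof.
have mK : measurable_fun setT (K k).
  have mi i : measurable_fun setT (fun x => kap g (x - to_circle (th k) *+ i)).
    have -> : (fun x => kap g (x - to_circle (th k) *+ i)) =
        arc (val g) \o (fun x => x + (- (to_circle (th k) *+ i) + g)).
      by apply/funext => x; rewrite /kap /= addrA.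
    by apply: measurableT_comp; [exact: measurable_arc_fun|exact: measurable_shiftc].
  exact: (@measurable_sum_int _ circle (b k * q k)
    (fun i x => kap g (x - to_circle (th k) *+ i)) mi).
have mKv : measurable_fun setT (K k \o (fun x => x - vv k)).
  by apply: measurableT_comp => //; exact: measurable_shiftc.
exact: (measurable_int_fun2 (fun z t => (-1) ^+ (~~ s k) * z) mKv mKv).
Qed.

Let b_near := stage_mult_near St.

Let far k x := near_edge (th k) g (eps k) (q k) (x - vv k).

(** Away from a small set the stage [k] transfer function is, up to a constant,
    [b k] times one of boundedly many integers, so [alpha] times it is close to
    a constant modulo 1. *)
Let transfer_near_int : exists cst : nat -> int, forall k x, ~ far k x ->
  exists P : int, `|alpha * (transfer k x - cst k)%:~R - P%:~R| <= 3 * w k.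
Proof.
pose fl k := Num.floor ((q k)%:R * val g : R).
exists (fun k => (-1) ^+ (~~ s k) * ((b k)%:Z * fl k)) => k x Hx.
have [P hP] := b_near k.
pose z := (-1) ^+ (~~ s k) * (ksum (th k) g (q k) (x - vv k) - fl k).
have e1 : eps k < 1 by have := eps_le k; have := w_le1 k; lra.
have zE : transfer k x - (-1) ^+ (~~ s k) * ((b k)%:Z * fl k) = (b k)%:Z * z.
  rewrite /transfer /K (ksum_block (dl_gt0 k) (thE k) e1 Hx) -mulrBr -mulrBr /z.
  by rewrite mulrCA.
exists (P * z); rewrite zE intrM intrM -pmulrn mulrA [alpha * _]mulrC -mulrBl normrM [leRHS]mulrC.
have z3 : `|z%:~R : R| <= 3.
  rewrite /z intrM normrM rmorphXn /= rmorphN1 normrX normrN1 expr1n mul1r.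
  have ql : (q k)%:R * dl k <= 1 by have := dl_le k; have := w_le1 k; lra.
  have := ksum_discrepancy (q_gt0 k) (dl_gt0 k) (thE k) (bezout k) g (x - vv k) ql.
  have := ge_floor ((q k)%:R * val g : R); have := floorD1_gt ((q k)%:R * val g : R).
  rewrite -/(fl k) intrD intrB !ler_norml => f1 f2 /andP[h1 h2].
  by apply/andP; split; lra.
by apply: ler_pM.
Qed.

Let small_far n0 : small (w n0 / 8) (\bigcup_k far (n0 + k)).
Proof.
apply: small_cup => k.
have U := small_shift (- vv (n0 + k))
  (small_near_edge (th (n0 + k)) g (q (n0 + k)) (ltW (eps_gt0 (n0 + k)))).
apply: small_le _ U; rewrite -decayE; have := short (n0 + k); rewrite -/(eps _).
have := decayD R n0 k; have := wS k => -> -> h; rewrite mulrDr; lra.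
Qed.

Local Notation E := (essential_values mu (rotation alpha) (rotation (- alpha)) phi).

Let zero_essential : E 0.
Proof.
move=> V V0 C mC C0; exists 0; rewrite /iterz /cocycle_sum /=.
have VT : [set x : circle | V (\sum_(j < 0) phi (iter j (rotation alpha) x))] = setT.
  apply/seteqP; split=> // x _ /=; rewrite big_ord0; exact: nbhs_singleton V0.
by rewrite VT setIT setIid.
Qed.

Let haar_atom (y : int) : E y ->
  exists2 e : R, 0 < e & forall B, B y -> (e%:E <= haar R E B)%E.
Proof. by move=> Ey; exists 1 => // C Cy; apply: (@counting_ge1 R _ _ y). Qed.

(** Only the end point of the step stays in all the tails. *)
Let tail_eventually x : x != to_circle beta ->
  exists n1, forall n, (n1 <= n)%N -> ~ tail n x.
Proof.
move=> xb; have [h|h] := ltP beta (val x).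
  by exists 0%N => n _ /andP[_ h']; move: h; rewrite ltNge h'.
have xb' : val x < beta.
  rewrite lt_neqAle h andbT; apply: contra xb => /eqP <-.
  by rewrite to_circleK.
have [K1 hK] := decay_small (ltac:(by rewrite subr_gt0) : 0 < beta - val x).
exists K1 => n K1n /andP[h1 _].
have := cut_points_cvg n; have := hK _ K1n; have := w_gt0 n.
rewrite ler_norml => h2 h3 /andP[h4 _]; rewrite -/B -/beta in h4; lra.
Qed.

(** If 0 is the only essential value, regularity makes the cocycle a coboundary, and
    the graph of the transfer function modulo 2 is an invariant set of measure 1/2.

    Otherwise let [a] be a nonzero essential value. Subtracting from the fibre
    coordinate the transfer functions of the first [n] stages, recentred, gives
    integers [Y n] that are eventually invariant at almost every point. Modulo 1,
    [alpha * Y n] is nearly constant for [n >= n0] outside a small set. Hence the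
    set where it is infinitely often in a given short arc is null or full; it is
    full for some arc, at height 0 as well as at height [a]. So [alpha * a] would be
    arbitrarily close to an integer. *)
Lemma not_regular : ~ regular_cocycle mu (rotation alpha) (rotation (- alpha)) phi.
Proof.
move=> [eta [psi [meta mpsi [C [mC C0 badC]] Epsi erg]]].
pose bad := [set x | psi x <> phi x + eta x - eta (x + d)].
have null_bad : small 0 bad.
  by exists C => //; split; [exact: badC|rewrite C0].
case: (pselect (exists2 a, E a & a != 0)) => [[a Ea a0]|none]; last first.
  have psi0 x : psi x = 0.
    apply: contrapT => /eqP h; apply: none; exists (psi x) => //; exact: Epsi.
  (* The graph of the transfer function modulo 2. *)
  pose A := [set z : circle * Zmod 2 | z.2 = residue 2 (eta z.1)].
  have mA : measurable A.
    have mr : measurable_fun setT (residue 2 \o (eta \o fst) : circle * Zmod 2 -> Zmod 2).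
      by apply: measurableT_comp => //; exact: measurableT_comp.
    have := @measurable_discrete2 _ (circle * Zmod 2)%type _ (Zmod 2) _ (Zmod 2) _ bool
      (residue 2 \o (eta \o fst)) snd (fun t y => y == t) (countableP _).
    move=> /(_ _ _ mr measurable_snd measurableT [set true]).
    rewrite setTI => H.
    have -> : A = (fun z : circle * Zmod 2 => z.2 == residue 2 (eta z.1)) @^-1` [set true].
      by apply/seteqP; split => z /= /eqP.
    by apply: H.
  have badA : small 0 [set x | ~ forall y, A (x, y) <->
      A (skew_product (rotation alpha) (fun x => residue 2 (phi x)) (x, y))].
    apply: small_sub null_bad => x H; apply: contrapT => /contrapT Hx; apply: H => y.
    rewrite /A /skew_product /= -/d; move: Hx; rewrite psi0 => Hx.
    have -> : residue 2 (phi x) = residue 2 (eta (x + d)) - residue 2 (eta x).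
      apply: (addIr (residue 2 (eta x))); rewrite subrK -residueD //; congr residue.
      by move: Hx; move: (phi x) (eta x) (eta (x + d)) => i1 i2 i3; clear; lia.
    split=> [->|/(canRL (addrK _))->]; first by rewrite addrC subrK.
    by rewrite opprB addrC subrK.
  have ge0 B' : (0 <= uniform_Zmod R 2 B')%E by exact: measure_ge0.
  have := ergodic_null_or_full (c := d) ge0 _ (quotient_ergodic (a := 2) isT) mA badA.
  case=> // h.
    apply: (@smallT R).
    have h' k : small 0 [set x | A (x, inord k)] by apply: h; exact: uniform_Zmod_atom.
    apply: small_sub (null_cup h') => x _; exists (val (residue 2 (eta x))) => //.
    by change (A (x, inord (val (residue 2 (eta x))))); rewrite inord_val.
  apply: (@smallT R); rewrite -[0]addr0.
  have two0 : (2 : int) != 0 by [].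
  have h1 := h 0 (uniform_Zmod_atom R two0 0).
  have h2 := h (residue 2 1) (uniform_Zmod_atom R two0 _).
  apply: small_sub (smallU h1 h2) => x _; apply: contrapT => /not_orP[/contrapT H1 /contrapT H2].
  by move: H2; rewrite /A /= /A /= in H1 *; rewrite -H1.
have [cst hcst] := transfer_near_int.
have [e e0 gap] := irrational_gap irr a0.
have [n0 hn0] := decay_small (ltac:(by rewrite divr_gt0) : 0 < e / 48).
have {}hn0 := hn0 n0 (leqnn _).
pose Y n (z : circle * int) : int := z.2 + eta z.1 - \sum_(k < n) (transfer k z.1 - cst k).
(* Two points in one of [N] equal arcs are at distance less than [e / 2], and the
   tails of the series contribute at most [12 * w n0 < e / 4]. *)
pose N := (Num.truncn (2 / e)).+1.
have N0 : (0 : R) < N%:R by rewrite ltr0n.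
have Ne : N%:R^-1 < e / 2.
  rewrite -[ltRHS]invrK ltf_pV2 ?posrE ?invr_gt0 ?divr_gt0 // invf_div.
  exact: truncnS_gt.
pose fr (m : int) : R := val (to_circle (alpha * m%:~R)).
pose idx (m : int) : 'I_N := inord (Num.truncn (N%:R * fr m)).
have idxE m : (idx m)%:R <= N%:R * fr m < (idx m)%:R + 1.
  have /andP[f0 f1] := val_itv (to_circle (alpha * m%:~R)); rewrite -/(fr m) in f0 f1.
  have Nf0 : 0 <= N%:R * fr m by rewrite mulr_ge0 // ltW.
  have -> : (idx m : nat) = Num.truncn (N%:R * fr m).
    rewrite /idx inordK // truncn_lt_nat // -[X in _ < X]mulr1 ltr_pM2l //.
  by have := truncn_itv Nf0; rewrite -natr1.
have idx_close m m' : idx m = idx m' ->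
    exists P : int, `|alpha * (m - m')%:~R - P%:~R| < N%:R^-1.
  move=> ii; exists (Num.floor (alpha * m%:~R) - Num.floor (alpha * m'%:~R)).
  have -> : alpha * (m - m')%:~R - (Num.floor (alpha * m%:~R) - Num.floor (alpha * m'%:~R))%:~R
      = fr m - fr m' :> R.
    by rewrite /fr /= !intrB; lra.
  have := idxE m; have := idxE m'; rewrite ii => /andP[i1 i2] /andP[i3 i4].
  rewrite -[X in X < _](mulKf (lt0r_neq0 N0)) -[ltRHS]mulr1 ltr_pM2l ?invr_gt0 //.
  rewrite -[X in X * _]gtr0_norm // -normrM ltr_norml.
  by apply/andP; split; lra.
pose A i := [set z : circle * int | forall M, exists2 n, (M <= n)%N & idx (Y n z) = i].
have mY n : measurable_fun setT (Y n).
  have m1 : measurable_fun setT (fun z : circle * int => z.2 + eta z.1).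
    exact: (measurable_int_fun2 (fun s t => s + t) measurable_snd
      (measurableT_comp meta measurable_fst)).
  have mt k : measurable_fun setT (fun z : circle * int => transfer k z.1 - cst k).
    have mk := measurableT_comp (measurable_transfer k) (measurable_fst : measurable_fun setT (@fst circle int)).
    exact: (measurable_int_fun2 (fun s t => s - cst k) mk mk).
  exact: (measurable_int_fun2 (fun s t => s - t) m1 (measurable_sum_int n mt)).
have mA i : measurable (A i).
  have -> : A i = \bigcap_M \bigcup_(n in [set n | (M <= n)%N]) (Y n @^-1` [set m | idx m = i]).
    apply/seteqP; split => z H M.
      by move=> _; have [n Mn hn] := H M; exists n.
    by have [n Mn hn] := H M Logic.I; exists n.
  apply: bigcap_measurable; first by exists 0%N.
  move=> M _; apply: bigcup_measurable => n _.
  by rewrite -[X in measurable X]setTI; exact: mY.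
have badA i : small 0 [set x | ~ forall y, A i (x, y) <->
    A i (skew_product (rotation alpha) psi (x, y))].
  have nb := null_point (to_circle beta).
  have := smallU null_bad (smallU nb (small_shift g nb)); rewrite !addr0.
  apply: small_sub => x H; apply: contrapT => /not_orP[/contrapT Hx /not_orP[xb xg]]; apply: H => y.
  have [n1 h1] := tail_eventually (introN eqP xb).
  have [n2 h2] := tail_eventually (introN eqP xg).
  have YS n : (n1 + n2 <= n)%N -> Y n (skew_product (rotation alpha) psi (x, y)) = Y n (x, y).
    move=> nn; rewrite /Y /skew_product /= -/d Hx.
    rewrite (step_cocycle_transfer (h1 n _) (h2 n _)); last 2 first.
    - by apply: leq_trans nn; exact: leq_addr.
    - by apply: leq_trans nn; exact: leq_addl.
    rewrite !sumrB -!/(transfer_sum _ _).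
    move: (transfer_sum _ _) (transfer_sum _ _) (eta _) (eta _) (\sum_(k < n) cst k).
    by clear => *; lia.
  split=> H M; have [n Mn hn] := H (M + (n1 + n2))%N; exists n.
  - exact: leq_trans (leq_addr _ _) Mn.
  - by rewrite YS // (leq_trans (leq_addl _ _) Mn).
  - exact: leq_trans (leq_addr _ _) Mn.
  - by rewrite -YS // (leq_trans (leq_addl _ _) Mn).
have ge0 B' : (0 <= haar R E B')%E by exact: measure_ge0.
have [i hi] : exists i, forall y, E y -> small 0 [set x | ~ A i (x, y)].
  apply: contrapT => /forallNP H; apply: (@smallT R).
  have h0 k : small 0 [set x | A (inord k) (x, 0)].
    have := ergodic_null_or_full (c := d) ge0 _ erg (mA (inord k)) (badA (inord k)).
    case=> // h; first by apply: h; exact: haar_atom zero_essential.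
    by case: (H (inord k)) => y Ey; apply: h; exact: haar_atom.
  apply: small_sub (null_cup h0) => x _.
  have [i hi] := infinitely_often (fun n => idx (Y n (x, 0))).
  by exists (val i) => //; change (A (inord (val i)) (x, 0)); rewrite inord_val.
have U := smallU (hi 0 zero_essential) (smallU (hi a Ea) (small_far n0)).
have [x] := small_exists U (ltac:(have := w_le1 n0; lra)).
move=> /not_orP[/contrapT H0 /not_orP[/contrapT Ha Hfar]].
have close n y : exists P : int,
    `|alpha * (Y (n0 + n)%N (x, y) - Y n0 (x, y))%:~R - P%:~R| <= 6 * (w n0 - w (n0 + n)).
  elim: n => [|n [P hP]]; first by exists 0; rewrite addn0 !subrr mulr0 subrr normr0 mulr0.
  have [P' hP'] := hcst (n0 + n)%N x (fun h => Hfar (ex_intro2 _ _ n Logic.I h)).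
  exists (P - P').
  have -> : Y (n0 + n.+1)%N (x, y) - Y n0 (x, y) =
      Y (n0 + n)%N (x, y) - Y n0 (x, y) - (transfer (n0 + n) x - cst (n0 + n)%N).
    by rewrite /Y addnS big_ord_recr /=; ring.
  move: (Y _ _ - Y _ _) (transfer _ _ - _) hP hP' => D T hP hP'.
  have -> : alpha * (D - T)%:~R - (P - P')%:~R =
      (alpha * D%:~R - P%:~R) - (alpha * T%:~R - P'%:~R) by rewrite !intrB; ring.
  apply: le_trans (ler_normB _ _) _; rewrite addnS.
  by have := wS (n0 + n); lra.
have [n n0n hn] := H0 n0; have [n' n0n' hn'] := Ha n0.
have [P hP] := idx_close _ _ (etrans hn' (esym hn)).
have [P1 hP1] := close (n - n0)%N 0; have [P2 hP2] := close (n' - n0)%N a.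
rewrite !subnKC // in hP1 hP2.
have := gap (P - P2 + P1); apply/negP; rewrite -ltNge.
have YE : Y n0 (x, a) = Y n0 (x, 0) + a by rewrite /Y /=; ring.
have -> : alpha * a%:~R - (P - P2 + P1)%:~R =
   (alpha * (Y n' (x, a) - Y n (x, 0))%:~R - P%:~R)
   - (alpha * (Y n' (x, a) - Y n0 (x, a))%:~R - P2%:~R)
   + (alpha * (Y n (x, 0) - Y n0 (x, 0))%:~R - P1%:~R) :> R.
  by rewrite YE !(intrB, intrD); ring.
apply: le_lt_trans (ler_normD _ _) _.
have := ler_normB (alpha * (Y n' (x, a) - Y n (x, 0))%:~R - P%:~R)
  (alpha * (Y n' (x, a) - Y n0 (x, a))%:~R - P2%:~R).
have := w_gt0 n; have := w_gt0 n'; lra.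
Qed.

End Transfer.
End Data.
End Construction.


(** * Existence of the construction and conclusion *)
Section Existence.
Variable R : realType.
Local Notation circle := (circle R).
Local Notation mu := (@circle_measure R).
Local Notation w := (decay R).
Implicit Types (x : circle).

Lemma unbounded_quot (alpha : R) (M N0 : nat) : ~ bounded_type alpha ->
  exists2 N, (N0 <= N)%N & (M <= cf_quot alpha N.+1)%N.
Proof.
move=> unb; apply: contrapT => H; apply: unb.
exists (maxn M (\max_(i < N0.+1) cf_quot alpha i)%N) => n n0.
have [nN|nN] := leqP n N0.
  by rewrite leq_max (leq_bigmax (Ordinal (nN : (n < N0.+1)%N))) orbT.
rewrite leq_max leqNgt; apply/orP; left; apply/negP => Mn; apply: H.
by exists n.-1; [rewrite -ltnS prednK|rewrite prednK // ltnW].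
Qed.

(** Some multiple of [k! * alpha] is close to [- alpha] modulo 1. *)
Lemma near_integer_multiplier (alpha : R) k : irrational alpha ->
  exists b : nat, [/\ (0 < b)%N, forall n, (0 < n <= k)%N -> b = 1 %[mod n] &
    exists P : int, `|b%:R * alpha - P%:~R| <= w k].
Proof.
move=> irr; have irr' := irrational_natM irr (fact_gt0 k).
have [m [P /andP[h1 h2]]] := natmul_irrational_dense (- alpha) irr' (decay_gt0 R k).
exists (m * k`! + 1)%N; split; first by rewrite addn1.
  by move=> n /dvdn_fact nk; rewrite -modnDml -modnMmr (eqP nk) muln0 mod0n.
exists P; rewrite natrD natrM mulrDl mul1r -mulrA.
by rewrite ger0_norm; lra.
Qed.

Lemma circle_norm_le (t : R) : 0 <= circle_norm (to_circle t) <= `|t|.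
Proof.
rewrite /circle_norm; have /andP[v0 v1] := val_itv (to_circle t).
have h0 : 0 <= Num.min (val (to_circle t)) (1 - val (to_circle t)).
  by rewrite le_min v0 subr_ge0 ltW.
apply/andP; split; first by [].
have [t0|t0] := leP 0 t.
  have [t1|t1] := ltP t 1.
    by rewrite ger0_norm // val_to_circle ?t0 // ge_min lexx.
  by rewrite ger0_norm // ge_min (le_trans (ltW v1) t1).
have [t1|t1] := ltP (-1) t.
  have e : val (to_circle t) = t - (-1)%:~R.
    by apply: val_to_circleE; rewrite mulrN1z; apply/andP; split; lra.
  by rewrite ltr0_norm // ge_min e mulrN1z; apply/orP; right; lra.
by rewrite ltr0_norm // ge_min; apply/orP; left; lra.
Qed.

(** Frequencies tending to infinity: a translation by half a period of the k-th
    one is tiny, yet exchanges the points where it is close to and far from an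
    integer. *)
Lemma null_not_separated (q : nat -> nat) :
  (forall k, (k <= q k)%N) -> (forall k, (0 < q k)%N) ->
  small 0 [set x : circle | ~ forall N, exists2 k, (N <= k)%N & 1 / 4 <= val (x *+ q k) <= 3 / 4].
Proof.
move=> qk q0.
pose L k := [set x : circle | ~~ (1 / 4 <= val (x *+ q k) <= 3 / 4)].
pose C N := \bigcap_(k in [set k | (N <= k)%N]) L k.
apply: small_sub (null_cup (P := C) _).
  move=> x /= /existsNP[N H]; exists N => // k /= Nk; apply/negP => h.
  by apply: H; exists k.
move=> N.
have mL k : measurable (L k).
  have mq n : measurable_fun setT (fun x : circle => x *+ n).
    elim: n => [|n IH]; first exact: measurable_cst.
    have -> : (fun x : circle => x *+ n.+1) = (fun z : circle * circle => z.1 + z.2) \o (fun x => (x *+ n, x)).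
      by apply/funext => x; rewrite /= mulrSr.
    apply: measurableT_comp; first exact: measurable_addc.
    exact: measurable_fun_pair.
  pose I := [set x : circle | 1 / 4 <= val x <= 3 / 4].
  have mI : measurable I.
    have := @measurable_circle_val R measurableT _ (measurable_itv `[(1 / 4), (3 / 4)]).
    by rewrite setTI; congr measurable; apply/seteqP; split => x /=; rewrite in_itv.
  have -> : L k = ~` ((fun x => x *+ q k) @^-1` I).
    by apply/seteqP; split => x /= /negP.
  by apply: measurableC; rewrite -[X in measurable X]setTI; exact: mq.
have mC : measurable (C N).
  by apply: bigcap_measurable => //; exists N => /=.
apply: small_measure => //; rewrite (null_smallP mC) // => e e0.
have [h h0 hC] := shift_continuous mC e0.
pose k := (N + (Num.truncn h^-1).+1)%N.
have kh : h^-1 < (q k)%:R.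
  apply: lt_le_trans (truncnS_gt _) _; rewrite ler_nat.
  by apply: leq_trans (qk k); exact: leq_addl.
have qk0 : (0 : R) < (q k)%:R by rewrite ltr0n.
have qk1 : (1 : R) <= (q k)%:R by rewrite ler1n.
pose t := to_circle ((2 * (q k)%:R)^-1 : R).
have tlt : (2 * (q k)%:R)^-1 < (q k)%:R^-1 :> R.
  by rewrite ltf_pV2 ?posrE ?mulr_gt0 //; lra.
have tinv : (q k)%:R^-1 < h by rewrite -[ltRHS]invrK ltf_pV2 ?posrE ?invr_gt0.
have q1 : (q k)%:R^-1 <= 1 :> R by rewrite invf_le1.
have tv : val t = (2 * (q k)%:R)^-1.
  by apply: val_to_circle; rewrite invr_ge0 mulr_ge0 //= (lt_le_trans tlt).
have th : val t < h by rewrite tv; exact: lt_trans tlt tinv.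
apply: small_sub (hC t th) => x Cx /= H.
have Nk : (N <= k)%N by exact: leq_addr.
have L1 : L k x by exact: Cx.
have L2 : L k (x + t) by have [+ _] := H; move=> /(_ Cx); apply.
have half : t *+ q k = to_circle (1 / 2).
  by rewrite -to_circleMn; congr to_circle; field; rewrite gt_eqF.
move: L1 L2; rewrite /L /= mulrnDl half -[x *+ q k]to_circleK -to_circleD.
have /andP[] := val_itv (x *+ q k); move: (val (x *+ q k)) => y y0 y1.
rewrite val_to_circle ?y0 // => /negP L1 /negP; apply.
have [y2|y2] := ltP y (1 / 2).
  rewrite val_to_circle; last by apply/andP; split; lra.
  apply/andP; split; first by lra.
  by rewrite leNgt; apply/negP => h'; apply: L1; apply/andP; split; lra.
rewrite (@val_to_circleE _ _ 1); last by rewrite mulr1z; apply/andP; split; lra.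
rewrite mulr1z; apply/andP; split; last by lra.
by rewrite leNgt; apply/negP => h'; apply: L1; apply/andP; split; lra.
Qed.

(** The multipliers are fixed first; each index is then chosen so far out that its
    partial quotient exceeds the multiplier and its denominator the accumulated
    weight of the earlier stages. *)
Lemma exists_stages (alpha : R) :
  0 < alpha -> alpha < 1 -> irrational alpha -> ~ bounded_type alpha ->
  exists s n q b c p u v dl, stages (R := R) alpha s n q b c p u v dl.
Proof.
move=> alpha_gt0 alpha_lt1 alpha_irr alpha_unbounded.
have /choice[b hb] := fun k => near_integer_multiplier k alpha_irr.
have b_gt0 k : (0 < b k)%N by case: (hb k).
have b_mod k n : (0 < n <= k)%N -> b k = 1 %[mod n] by case: (hb k) => _ + _; apply.
have b_near k : exists P : int, `|(b k)%:R * alpha - P%:~R| <= w k by case: (hb k).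
pose qq N := cf_den alpha N.
have conv N : exists puv : int * int * int,
    [/\ puv.1.2 * puv.1.1 + puv.2 * (qq N)%:Z = 1,
        0 < `|(qq N)%:R * alpha - puv.1.1%:~R| &
        `|(qq N)%:R * alpha - puv.1.1%:~R| * ((cf_quot alpha N.+1)%:R * (qq N)%:R) <= 1].
  by have [p [u [v H]]] := convergentP alpha_gt0 alpha_lt1 alpha_irr N; exists (p, u, v).
have {conv}/choice[puv hpuv] := conv.
pose D N := (qq N)%:R * alpha - (puv N).1.1%:~R.
pose dd N := `|D N|.
(* The largest number of steps [dd N] that fit into a sixteenth of the spacing of
   the tower. *)
pose cc N := Num.truncn ((16 * ((qq N)%:R * dd N))^-1).
pose F k N := (b k * qq N + cc N * qq N + N.+1)%N.
have qq_gt0 N : (0 < qq N)%N := cf_den_gt0 alpha_gt0 alpha_lt1 alpha_irr N.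
have qq_ge N : (N <= qq N)%N := leq_cf_den alpha_gt0 alpha_lt1 alpha_irr N.
have step k S : exists N, [/\ (S < N)%N, (32 * 2 ^ k * b k <= cf_quot alpha N.+1)%N &
    (32 * 2 ^ k * S <= qq N)%N].
  have [N NS aN] := unbounded_quot (32 * 2 ^ k * b k) (32 * 2 ^ k * S + S).+1 alpha_unbounded.
  exists N; split=> //.
    by apply: leq_trans NS; rewrite ltnS leq_addl.
  by apply: leq_trans (qq_ge N); apply: leq_trans (ltnW NS); exact: leq_addr.
have [n hn] := history_choice F step.
pose q k := qq (n k); pose dl k := dd (n k); pose c k := cc (n k).
pose s k := D (n k) < 0.
pose p k := (-1) ^+ s k * (puv (n k)).1.1.
pose u k := (-1) ^+ s k * (puv (n k)).1.2.
pose v k := (puv (n k)).2.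
have q_gt0 k : (0 < q k)%N := qq_gt0 (n k).
have q0 k : (0 : R) < (q k)%:R by rewrite ltr0n.
have dl_gt0 k : 0 < dl k by case: (hpuv (n k)).
have thE k : (q k)%:R * ((-1) ^+ s k * alpha) = (p k)%:~R + dl k.
  rewrite /p /dl /dd intrM rmorphXn /= rmorphN1.
  have -> : `|D (n k)| = (-1) ^+ s k * D (n k).
    rewrite /s; case: (ltP (D (n k)) 0) => h; first by rewrite ltr0_norm // expr1 mulN1r.
    by rewrite ger0_norm // expr0 mul1r.
  by rewrite /D -/(q k); ring.
have bezout k : u k * p k + v k * (q k)%:Z = 1.
  have [h _ _] := hpuv (n k); rewrite -h /u /p mulrACA -expr2 sqrr_sign mul1r.
  by [].
have sharp k : (b k)%:R / (cf_quot alpha (n k).+1)%:R <= w k / 32.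
  have [_ h _] := hn k.
  have a0 : (0 : R) < (cf_quot alpha (n k).+1)%:R.
    by rewrite ltr0n cf_quot_gt0.
  rewrite ler_pdivrMr // decayE.
  have t0 : (0 : R) < (2 ^ k)%:R by rewrite ltr0n expn_gt0.
  have -> : (b k)%:R = (2 ^ k)%:R^-1 / 32 * (32 * 2 ^ k * b k)%:R :> R.
    by rewrite !natrM; field; rewrite gt_eqF.
  by rewrite ler_wpM2l ?ler_nat // divr_ge0 // invr_ge0.
have short k : (q k)%:R * ((b k)%:R * dl k) <= w k / 32.
  apply: le_trans (sharp k); have [_ _ h] := hpuv (n k).
  have a0 : (0 : R) < (cf_quot alpha (n k).+1)%:R.
    by rewrite ltr0n cf_quot_gt0.
  rewrite ler_pdivlMr // -[leRHS]mulr1.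
  have := ler_wpM2l (ler0n R (b k)) h; rewrite -/(D _) -/(dd _) -/(dl k) -/(q k).
  by rewrite mulr1; apply: le_trans; rewrite le_eqVlt; apply/orP; left; apply/eqP; ring.
have weight_le k : (weight b c q k + k <= \sum_(j < k) F j (n j))%N.
  rewrite /weight; elim: k => [|k IH]; first by rewrite !big_ord0.
  have Fk : F k (n k) = (b k * q k + c k * q k + (n k).+1)%N by [].
  rewrite !big_ord_recr /= Fk.
  have add (X Y Z m : nat) : (X + k <= Y -> X + Z + k.+1 <= Y + (Z + m.+1))%N.
    by clear; lia.
  exact: add.
have sparse k : (weight b c q k)%:R <= w k / 32 * (q k)%:R.
  have [_ _ h] := hn k; have t0 : (0 : R) < (2 ^ k)%:R by rewrite ltr0n expn_gt0.
  rewrite decayE -mulrA ler_pdivlMl // ler_pdivlMl // -!natrM ler_nat mulnA.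
  apply: leq_trans h; rewrite leq_mul //.
  by apply: leq_trans (weight_le k); exact: leq_addr.
have height k : 1 / 32 <= (q k)%:R * ((c k)%:R * dl k) <= 1 / 16.
  have ql : (q k)%:R * dl k <= 1 / 32.
    apply: le_trans (_ : w k / 32 <= _); last first.
      by have := decay_le1 R k; lra.
    apply: le_trans (short k); rewrite ler_wpM2l //.
    by apply: ler_peMl; [exact: ltW|rewrite ler1n].
  have qd0 : 0 < (q k)%:R * dl k by rewrite mulr_gt0.
  have X0 : 0 <= (16 * ((q k)%:R * dl k))^-1 by rewrite invr_ge0 mulr_ge0 // ltW.
  have cE : c k = Num.truncn (16 * ((q k)%:R * dl k))^-1 by [].
  have /andP[c1 c2] := truncn_itv X0; rewrite -cE in c1 c2.
  have XE : (q k)%:R * dl k * (16 * ((q k)%:R * dl k))^-1 = 1 / 16.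
    by field; rewrite !gt_eqF.
  have aux (Q C Dl X : R) : 0 <= Q * Dl -> Q * Dl <= 1 / 32 -> Q * Dl * X = 1 / 16 ->
      C <= X -> X <= C + 1 -> 1 / 32 <= Q * (C * Dl) <= 1 / 16.
    move=> h0 h1 XQ /(ler_wpM2l h0) h2 /(ler_wpM2l h0) h3; rewrite XQ in h2 h3.
    by apply/andP; split; lra.
  by apply: aux XE c1 _ => //; [exact: ltW|rewrite natr1 ltW].
have n_ge k : (k < n k)%N.
  have [h _ _] := hn k; apply: leq_ltn_trans h.
  by apply: leq_trans (weight_le k); exact: leq_addl.
by exists s, n, q, b, c, p, u, v, dl.
Qed.

(** Up to the index [J], the expansion is the sum of the pieces of the stages with
    [n k <= J], which lies between two approximations of [beta]. *)
Lemma step_length_H_set (alpha : R) s n q b c p u v dl :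
  0 < alpha -> alpha < 1 -> irrational alpha ->
  stages (R := R) alpha s n q b c p u v dl ->
  H_set 1 alpha (to_circle (step_length b dl)).
Proof.
move=> alpha_gt0 alpha_lt1 alpha_irr St.
have n_ge := stage_index St; have qE := stage_den St; have sharp := stage_quot St.
have thE := stage_gap St; have dl_gt0 := stage_gap_gt0 St.
have w0 k : 0 < w k := decay_gt0 R k.
(* Since [k < n k], the stages of index [j] are among the first [j]. *)
pose bb (j : nat) : int := \sum_(k < j.+1 | n k == j) (-1) ^+ s k * (b k)%:Z.
exists bb; split.
  have bound j J : (j < J)%N ->
      `|(bb j)%:~R : R| `^ 1 / (cf_quot alpha j.+1)%:R <= \sum_(k < J | n k == j) w k / 32.
    move=> jJ; rewrite powRr1 //.
    have wide : \sum_(k < j.+1 | n k == j) w k / 32 = \sum_(k < J | n k == j) w k / 32.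
      rewrite (big_ord_widen_cond J (fun k => n k == j) (fun k => w k / 32)) //.
      apply: eq_bigl => k; case: eqP => //= nk.
      by rewrite ltnS -nk ltnW.
    rewrite -wide /bb rmorph_sum /= ler_pdivrMr ?ltr0n ?cf_quot_gt0 //.
    apply: le_trans (ler_norm_sum _ _ _) _; rewrite mulr_suml.
    apply: ler_sum => k /eqP nk.
    rewrite intrM normrM rmorphXn /= rmorphN1 normrX normrN1 expr1n mul1r -pmulrn normr_nat.
    by have := sharp k; rewrite nk ler_pdivrMr // ltr0n cf_quot_gt0.
  have partial J : \sum_(1 <= j < J) `|(bb j)%:~R : R| `^ 1 / (cf_quot alpha j.+1)%:R <= 1.
    apply: (@le_trans _ _ (\sum_(1 <= j < J) \sum_(k < J | n k == j) w k / 32)).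
      by rewrite !big_nat; apply: ler_sum => j /andP[_ jJ]; exact: bound.
    rewrite (exchange_big_dep xpredT) //=.
    apply: (@le_trans _ _ (\sum_(k < J) w k / 32)).
      apply: ler_sum => k _; rewrite big_mkcond /=.
      have [nJ|nJ] := boolP (n k \in index_iota 1 J).
        rewrite (bigD1_seq (n k)) ?iota_uniq //= eqxx big1 ?addr0 // => j jn.
        by rewrite eq_sym (negbTE jn).
      rewrite big_seq big1 ?divr_ge0 // ?ltW // => j jJ.
      by case: eqP => // nj; rewrite nj jJ in nJ.
    have tele m : \sum_(k < m) w k / 32 = (1 - w m) / 16.
      elim: m => [|m IH]; first by rewrite big_ord0 /decay expr0 subrr mul0r.
      by rewrite big_ord_recr /= IH; have := decayS R m; lra.
    by rewrite tele; have := w0 J; lra.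
  apply: (@le_lt_trans _ _ 1%E); last by rewrite ltry.
  have nn j : (0 <= (`|(bb j)%:~R : R| `^ 1 / (cf_quot alpha j.+1)%:R)%:E)%E.
    by rewrite lee_fin divr_ge0 // powR_ge0.
  apply: lime_le; first by apply: is_cvg_nneseries => j _ _; exact: nn.
  by apply: nearW => J; rewrite sumEFin lee_fin.
have cb := cut_points_cvg St.
have partial J : to_circle (\sum_(1 <= j < J.+1) (bb j)%:~R * (cf_den alpha j)%:R * alpha) =
    to_circle (\sum_(k < J.+1 | (n k <= J)%N) (b k)%:R * dl k).
  apply/to_circle_eqP.
  exists (\sum_(k < J.+1 | (n k <= J)%N) (b k)%:Z * p k).
  have -> : \sum_(1 <= j < J.+1) (bb j)%:~R * (cf_den alpha j)%:R * alpha =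
     \sum_(1 <= j < J.+1) \sum_(k < J.+1 | n k == j)
       (b k)%:R * ((q k)%:R * ((-1) ^+ s k * alpha)).
    rewrite !big_nat; apply: eq_bigr => j /andP[_ jJ].
    have -> : bb j = \sum_(k < J.+1 | n k == j) (-1) ^+ s k * (b k)%:Z.
      rewrite /bb (big_ord_widen_cond J.+1 (fun k => n k == j) (fun k => (-1) ^+ s k * (b k)%:Z)) //.
      apply: eq_bigl => k; case: eqP => //= nk.
      by rewrite ltnS -nk ltnW.
    rewrite rmorph_sum /= -mulrA mulr_suml; apply: eq_bigr => k /eqP nk.
    rewrite intrM rmorphXn /= rmorphN1 -pmulrn qE nk; ring.
  rewrite (exchange_big_dep xpredT) //=.
  have -> : \sum_(k < J.+1) \sum_(1 <= j < J.+1 | n k == j)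
       (b k)%:R * ((q k)%:R * ((-1) ^+ s k * alpha)) =
     \sum_(k < J.+1 | (n k <= J)%N) (b k)%:R * ((q k)%:R * ((-1) ^+ s k * alpha)).
    rewrite [RHS]big_mkcond /=; apply: eq_bigr => k _; rewrite big_mkcond /=.
    have mem : (n k \in index_iota 1 J.+1) = (n k <= J)%N.
      by rewrite mem_index_iota ltnS (leq_trans _ (n_ge k)).
    case: ifP => nJ.
      rewrite (bigD1_seq (n k)) ?mem ?iota_uniq //= eqxx big1 ?addr0 // => j jn.
      by rewrite eq_sym (negbTE jn).
    rewrite big_seq big1 // => j jJ.
    by case: eqP => // nj; rewrite -nj mem nJ in jJ.
  rewrite rmorph_sum /= -sumrB; apply: eq_bigr => k _.
  by rewrite thE intrM -pmulrn; ring.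
apply/cvgrPdist_lt => e e0.
have [K hK] := decay_small e0.
exists (K + \max_(k < K) n k)%N => // J /= KJ.
rewrite sub0r normrN partial -to_circleB.
set T := \sum_(k < J.+1 | _) _.
have /andP[cn0 cn] := circle_norm_le (T - step_length b dl).
rewrite ger0_norm //; apply: le_lt_trans cn _.
apply: (@le_lt_trans _ _ (w K)); last exact: hK.
have T1 : cut_points b dl K <= T.
  rewrite /cut_points (big_ord_widen J.+1 (fun k => (b k)%:R * dl k)); last first.
    by apply: leqW; apply: leq_trans KJ; exact: leq_addr.
  rewrite /T big_mkcond [leRHS]big_mkcond /=; apply: ler_sum => k _.
  case: ltnP => kK.
    have -> : (n k <= J)%N; last by [].
    apply: leq_trans KJ; apply: leq_trans (leq_addl _ _).
    exact: (leq_bigmax (Ordinal kK)).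
  by case: ifP => // _; rewrite mulr_ge0 // ltW.
have T2 : T <= cut_points b dl J.+1.
  rewrite /T /cut_points big_mkcond /=; apply: ler_sum => k _.
  by case: ifP => // _; rewrite mulr_ge0 // ltW.
have T3 : cut_points b dl J.+1 <= step_length b dl.
  exact: (cut_points_le St).
rewrite ler0_norm ?subr_le0 ?(le_trans T2) // opprB.
by have := cb K; have := w0 K; rewrite ler_norml => ? /andP[? _]; lra.
Qed.

End Existence.

Theorem theorem3p1 (R : realType) (alpha : R)
    (alpha_gt0 : 0 < alpha) (alpha_lt1 : alpha < 1)
    (alpha_irr : irrational alpha)
    (alpha_unbounded : ~ bounded_type alpha) :
  exists beta : circle R, H_set 1 alpha beta /\
    {ae (@lebesgue_measure R), forall gamma : R,
      ~ regular_cocycle (@circle_measure R)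
          (rotation alpha) (rotation (- alpha)) (step_cocycle beta gamma) /\
      forall a : int, a != 0 ->
        ergodic (@circle_measure R \x uniform_Zmod R a)%E
          (skew_product (rotation alpha)
            (fun x => residue a (step_cocycle beta gamma x)))}.
Proof.
have [s [n [q [b [c [p [u [v [dl St]]]]]]]]] :=
  exists_stages alpha_gt0 alpha_lt1 alpha_irr alpha_unbounded.
exists (to_circle (step_length b dl)); split; first exact: (step_length_H_set _ _ _ St).
have nq k : (k <= q k)%N.
  rewrite (stage_den St); apply: leq_trans (ltnW (stage_index St k)) _.
  exact: leq_cf_den.
have sep := null_not_separated R nq (stage_den_gt0 St).
apply: negligibleS (negligible_lift sep) => gamma /= H H'; apply: H; split.
  exact: (not_regular St).
exact: (quotient_ergodic St).
Qed.
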